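(* Let $\boldsymbol\pi=(\boldsymbol\pi_s)_{s\in\mathbb N}$ be a sequence of coordinatewise permutations ($\boldsymbol\pi_s(\mathbf m)=(\pi^1_s(m^1),\dots,\pi^d_s(m^d))$ with $\pi^j_s$ permutations of $\{0,\dots,2^{m_s}-1\}$), let $F^{\boldsymbol\pi}$ be as in the context, and let $G\subset\mathbb G^d$ be open with $G\cap F^{\boldsymbol\pi}\neq\emptyset$. Then $G\cap F^{\boldsymbol\pi}$ is an $M$-set for the $d$-dimensional Walsh system with respect to convergence by rectangles, by cubes, and repeated convergence for every order of iterated summation. Moreover there is a dyadic cube $\Delta^{(m_{s_0})}\subset G$ (of rank $m_{s_0}$ for some $s_0$) such that the $d$-fold Walsh series generating the quasimeasure $\tau_{F^{\boldsymbol\pi}}|_{\Delta^{(m_{s_0})}}$ realizes the $M$-set $G\cap F^{\boldsymbol\pi}$.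
   Context: Fix an integer $d\ge 2$. $\mathbb G$ is the dyadic group: sequences $g=(g_k)_{k\ge0}$, $g_k\in\{0,1\}$, coordinatewise addition mod 2, product topology (basis: dyadic cubes); $\mathbb G^d$ its $d$-th power. For $n\in\mathbb N_0$, $n=\sum_kn_k2^k$, $n_k\in\{0,1\}$. Dyadic interval of rank $k$: $\Delta^{(k)}_m=\{g: g_t=m_{k-1-t},\ 0\le t<k\}$; dyadic cube $\Delta^{(k)}_{\mathbf m}=\prod_l\Delta^{(k)}_{m^l}$. Vector order coordinatewise, $\mathbf 1=(1,\dots,1)$. Walsh functions $W_n(g)=\prod_k(-1)^{g_kn_k}$, $W_{\mathbf n}(\mathbf g)=\prod_lW_{n^l}(g^l)$; $W^{(k)}_{\mathbf n\mathbf m}$ is the constant value of $W_{\mathbf n}$ on $\Delta^{(k)}_{\mathbf m}$ ($\mathbf n,\mathbf m<2^k\mathbf 1$); $R_{k\mathbf 1}:=W_{2^k\mathbf 1}$. Partial sums $S_{\mathbf N}=\sum_{\mathbf n<\mathbf N}a_{\mathbf n}W_{\mathbf n}$; convergence by rectangles: $S_{\mathbf N}(\mathbf g)\to S$ as $\min_jN^j\to\infty$; by cubes: $S_{N\mathbf 1}(\mathbf g)\to S$; repeated: the iterated sum $\sum_{n^{j_1}}(\cdots\sum_{n^{j_d}}a_{\mathbf n}W_{\mathbf n}(\mathbf g))$ converges to $S$ for the permutation $(j_1,\dots,j_d)$. $A$ is an $M$-set if some series with not all coefficients zero converges to $0$ at every point outside $A$; such a series realizes $A$. Quasimeasure: $\tau$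 on dyadic cubes with $\tau(\Delta^{(k)}_{\mathbf m})=\sum_{\boldsymbol\sigma\in\{0,1\}^d}\tau(\Delta^{(k+1)}_{2\mathbf m+\boldsymbol\sigma})$; its generating series is $\sum\widehat\tau_{\mathbf n}W_{\mathbf n}$ with $\widehat\tau_{\mathbf n}=\sum_{\mathbf m<2^k\mathbf 1}W^{(k)}_{\mathbf n\mathbf m}\tau(\Delta^{(k)}_{\mathbf m})$ ($\mathbf n<2^k\mathbf 1$). For nonempty closed $E$, $\tau_E$ is the unique nonnegative quasimeasure with $\tau_E(\mathbb G^d)=1$, $\tau_E(\Delta)=0$ iff $\Delta\cap E=\emptyset$, which splits the value of a cube meeting $E$ equally among its $2^d$ children meeting $E$. The restriction to a dyadic cube $\widetilde\Delta$ is $\tau|_{\widetilde\Delta}(\Delta)=\tau(\widetilde\Delta\cap\Delta)$ (with value $0$ on $\emptyset$). Let $m_1=0$, $m_{s+1}=2(2m_s+1)$; $F^{\boldsymbol\pi}_s=\bigcup_{\mathbf m,\mathbf m'<2^{m_s}\mathbf 1}\{\mathbf g\in\Delta^{(2m_s)}_{2^{m_s}\mathbf m+\mathbf m'}: R_{2m_s\mathbf 1}(\mathbf g)=W^{(m_s)}_{\boldsymbol\pi_s(\mathbf m)\,\mathbf m'}\}$, $F^{\boldsymbol\pi}=\bigcap_sF^{\boldsymbol\pi}_s$. *)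

(* Defs.v *)
From HB Require Import structures.
From mathcomp Require Import all_boot all_order all_algebra all_fingroup.
From mathcomp Require Import boolp reals.

Set Implicit Arguments.
Unset Strict Implicit.
Unset Printing Implicit Defensive.

Import Order.TTheory GRing.Theory Num.Theory.
Local Open Scope ring_scope.

(* Points of G^d: g j t = t-th coordinate (0/1) of the j-th component g^j. *)
Definition pt (d : nat) := 'I_d -> nat -> bool.

Definition cube (d k : nat) (m : 'I_d -> nat) (g : pt d) : Prop :=
  forall (j : 'I_d) (t : nat), (t < k)%N -> g j t = odd (m j %/ 2 ^ (k.-1 - t)).

Definition is_open (d : nat) (U : pt d -> Prop) : Prop :=
  forall g, U g -> exists k (m : 'I_d -> nat),
    (forall j, (m j < 2 ^ k)%N) /\ cube k m g /\ (forall h, cube k m h -> U h).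

(* One-dimensional Walsh function W_n(x) = prod_k (-1)^(x_k n_k)
   (bits n_k vanish for k >= n since n < 2^n). *)
Definition W1 (R : realType) (n : nat) (x : nat -> bool) : R :=
  (-1) ^+ (\sum_(k < n) ((x k && odd (n %/ 2 ^ k)) : nat)).

Definition Wv (R : realType) (d : nat) (n : 'I_d -> nat) (g : pt d) : R :=
  \prod_(l < d) W1 R (n l) (g l).

Definition cube_pt (d k : nat) (m : 'I_d -> nat) : pt d :=
  fun j t => (t < k)%N && odd (m j %/ 2 ^ (k.-1 - t)).

(* W^{(k)}_{n m}: the constant value of W_n on Delta^{(k)}_m (n, m < 2^k 1). *)
Definition Wk (R : realType) (d k : nat) (n m : 'I_d -> nat) : R :=
  Wv R n (cube_pt k m).

Definition Rad (R : realType) (d k : nat) (g : pt d) : R :=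
  Wv R (fun _ : 'I_d => 2 ^ k)%N g.

Definition psum (R : realType) (d : nat) (a : ('I_d -> nat) -> R)
    (N : 'I_d -> nat) (g : pt d) : R :=
  \sum_(n : {ffun 'I_d -> 'I_(\max_(j < d) N j)} | [forall j, (n j < N j)%N])
     a (fun j => val (n j)) * Wv R (fun j => val (n j)) g.

Definition seq_cvg (R : realType) (u : nat -> R) (l : R) : Prop :=
  forall e : R, 0 < e -> exists K, forall n, (K <= n)%N -> `|u n - l| < e.

Definition cvg_rect (R : realType) (d : nat) (a : ('I_d -> nat) -> R)
    (g : pt d) (S : R) : Prop :=
  forall e : R, 0 < e -> exists K, forall N : 'I_d -> nat,
    (forall j, (K <= N j)%N) -> `|psum a N g - S| < e.

Definition cvg_cube (R : realType) (d : nat) (a : ('I_d -> nat) -> R)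
    (g : pt d) (S : R) : Prop :=
  seq_cvg (fun N => psum a (fun _ => N) g) S.

Definition upd (d : nat) (n0 : 'I_d -> nat) (j : 'I_d) (k : nat) : 'I_d -> nat :=
  fun i => if i == j then k else n0 i.

(* iter_sum [:: j1; ...; jr] f n0 S : the iterated series
   sum_{n^{j1}} ( ... sum_{n^{jr}} f(n) ) (other coordinates fixed as in n0)
   converges (every inner series converging) to S. *)
Fixpoint iter_sum (R : realType) (d : nat) (l : seq 'I_d)
    (f : ('I_d -> nat) -> R) (n0 : 'I_d -> nat) (S : R) : Prop :=
  match l with
  | [::] => S = f n0
  | j :: l' => exists b : nat -> R,
      (forall k, iter_sum l' f (upd n0 j k) (b k)) /\
      seq_cvg (fun K => \sum_(k < K) b k) S
  end.

Definition cvg_rep (R : realType) (d : nat) (l : seq 'I_d)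
    (a : ('I_d -> nat) -> R) (g : pt d) (S : R) : Prop :=
  iter_sum l (fun n => a n * Wv R n g) (fun _ => 0%N) S.

Definition realizes (R : realType) (d : nat)
    (cv : (('I_d -> nat) -> R) -> pt d -> R -> Prop)
    (A : pt d -> Prop) (a : ('I_d -> nat) -> R) : Prop :=
  (exists n, a n != 0) /\ (forall g, ~ A g -> cv a g 0).

Definition Mset (R : realType) (d : nat)
    (cv : (('I_d -> nat) -> R) -> pt d -> R -> Prop) (A : pt d -> Prop) : Prop :=
  exists a : ('I_d -> nat) -> R, realizes cv A a.

(* Quasimeasures are represented as functions tau k m = tau(Delta^{(k)}_m). *)
Definition meets (d : nat) (P Q : pt d -> Prop) : Prop := exists g, P g /\ Q g.

Fixpoint tauE (R : realType) (d : nat) (E : pt d -> Prop) (k : nat)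
    (m : 'I_d -> nat) : R :=
  match k with
  | 0 => 1
  | k'.+1 =>
      if `[< meets (cube k'.+1 m) E >] then
        tauE R E k' (fun j => m j %/ 2)%N /
        (#|[set s : {ffun 'I_d -> bool} |
             `[< meets (cube k'.+1 (fun j => 2 * (m j %/ 2) + s j)%N) E >]]|)%:R
      else 0
  end.

(* Restriction tau|_{Delta^{(k0)}_{m0}}(Delta) = tau(Delta^{(k0)}_{m0} cap Delta);
   the intersection of two dyadic cubes is the smaller one or empty. *)
Definition restr (R : realType) (d : nat) (tau : nat -> ('I_d -> nat) -> R)
    (k0 : nat) (m0 : 'I_d -> nat) (k : nat) (m : 'I_d -> nat) : R :=
  if (k0 <= k)%N then
    (if `[< forall g, cube k m g -> cube k0 m0 g >] then tau k m else 0)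
  else
    (if `[< forall g, cube k0 m0 g -> cube k m g >] then tau k0 m0 else 0).

(* Coefficients of the generating series: hat tau_n =
   sum_{m < 2^k 1} W^{(k)}_{n m} tau(Delta^{(k)}_m), with k = max_j n^j
   (so that n < 2^k 1). *)
Definition gen (R : realType) (d : nat) (tau : nat -> ('I_d -> nat) -> R)
    (n : 'I_d -> nat) : R :=
  let k := (\max_(j < d) n j)%N in
  \sum_(m : {ffun 'I_d -> 'I_(2 ^ k)})
     Wk R k n (fun j => val (m j)) * tau k (fun j => val (m j)).

(* mseq i = m_{i+1}: m_1 = 0, m_{s+1} = 2 (2 m_s + 1). *)
Fixpoint mseq (i : nat) : nat :=
  match i with
  | 0 => 0
  | i'.+1 => 2 * (2 * mseq i' + 1)
  end%N.

(* F^pi_{i+1}; pi i j is the permutation pi^j_{i+1} of {0,...,2^{m_{i+1}}-1}. *)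
Definition Fs (R : realType) (d : nat)
    (pi : forall i : nat, 'I_d -> {perm 'I_(2 ^ mseq i)}) (i : nat) (g : pt d) : Prop :=
  exists m m' : 'I_d -> 'I_(2 ^ mseq i),
    cube (2 * mseq i) (fun j => 2 ^ mseq i * m j + m' j)%N g /\
    Rad R (2 * mseq i) g =
      Wk R (mseq i) (fun j => val (pi i j (m j))) (fun j => val (m' j)).

Definition Fpi (R : realType) (d : nat)
    (pi : forall i : nat, 'I_d -> {perm 'I_(2 ^ mseq i)}) (g : pt d) : Prop :=
  forall i, Fs R pi i g.

(* Main.v *)
Require Import Defs.
From HB Require Import structures.
From mathcomp Require Import all_boot all_order all_algebra all_fingroup.
From mathcomp Require Import boolp reals.
From mathcomp Require Import zify ring lra.
Import Order.TTheory GRing.Theory Num.Theory.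
Local Open Scope ring_scope.

Set Implicit Arguments.
Unset Strict Implicit.
Unset Printing Implicit Defensive.

(* The quasimeasure of F is the Riesz product of the factors 1 + R_{2 m_s} Psi_s,
   where Psi_s is constant on cubes of rank 2 m_s and equals the Walsh function
   of index 2^{m_s} pi_s(m) on the cube of rank m_s and index m.  Restricting to
   a cube of rank m_{s0} only changes the frequencies below 2^{m_{s0}}, so the
   spectrum lies in a bounded box and in the diagonal blocks
   [2^{2 m_s}, 2^{2 m_s + 1})^d.  Hence a rectangular partial sum sees at most one
   incomplete block, and iterated sums are rectangular partial sums.

   Fix g outside the support.  The complete part vanishes near g.  In the
   incomplete block, orthogonality in the second half of the digits reduces the
   partial sum to a sum over the cubes m of rank m_s, weighted by products of
   Dirichlet kernels whose order is 0 or 2^{m_s} unless pi_s(m^l) is one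
   distinguished index.  Since the quasimeasure vanishes near g, each surviving
   m is far from g in some coordinate, where the kernel is bounded independently
   of s; the block is O(2^{- m_s / 2}). *)

(** * Walsh functions and Dirichlet kernels *)

Lemma odd_div_exp2_low (a b m n : nat) :
  (a < b)%N -> odd ((2 ^ b * m + n) %/ 2 ^ a) = odd (n %/ 2 ^ a).
Proof.
move=> lt_ab; rewrite -(subnKC (ltnW lt_ab)) expnD -mulnA mulnC divnMDl ?expn_gt0 //.
by rewrite oddD oddM oddX subn_eq0 leqNgt lt_ab.
Qed.

Lemma odd_div_exp2_high (a b m n : nat) :
  (n < 2 ^ b)%N -> odd ((2 ^ b * m + n) %/ 2 ^ (b + a)) = odd (m %/ 2 ^ a).
Proof.
move=> lt_n; rewrite expnD divnMA mulnC divnMDl ?expn_gt0 //.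
by rewrite (divn_small lt_n) addn0.
Qed.

Definition shift (k : nat) (x : nat -> bool) (t : nat) : bool := x (k + t)%N.

Definition xor (x y : nat -> bool) (t : nat) : bool := x t (+) y t.

(** One coordinate of [cube_pt k]: the binary digits of [m], most significant first, then zeros. It
    represents the dyadic interval of rank [k] and index [m]. *)
Definition digits (k m t : nat) : bool := (t < k)%N && odd (m %/ 2 ^ (k.-1 - t)).

(** The index of the dyadic interval of rank [k] containing [x]. *)
Fixpoint prefix_val (k : nat) (x : nat -> bool) : nat :=
  if k is k'.+1 then (2 * prefix_val k' x + x k')%N else 0%N.

Lemma digitsS (k m t : nat) :
  digits k.+1 m t = if (t < k)%N then digits k (m %/ 2) t else (t == k) && odd m.
Proof.
rewrite /digits ltnS leq_eqVlt /=; case: (ltngtP t k) => //= [lt_tk|->].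
  by rewrite -divnMA -expnS; congr (odd (_ %/ 2 ^ _)); lia.
by rewrite subnn divn1.
Qed.

Lemma digits_cat (a b m n t : nat) : (n < 2 ^ b)%N ->
  digits (a + b) (2 ^ b * m + n) t =
    if (t < a)%N then digits a m t else digits b n (t - a).
Proof.
move=> lt_n; rewrite /digits; case: (ltnP t a) => hta /=.
  rewrite (leq_trans hta) ?leq_addr //=.
  have -> : ((a + b).-1 - t = b + (a.-1 - t))%N by lia.
  by rewrite odd_div_exp2_high.
have -> : (t < a + b)%N = (t - a < b)%N by lia.
case: ltnP => //= h; rewrite odd_div_exp2_low; last by lia.
by congr (odd (_ %/ 2 ^ _)); lia.
Qed.

Lemma digits_inj (k m n : nat) : (m < 2 ^ k)%N -> (n < 2 ^ k)%N ->
  (forall t, (t < k)%N -> digits k m t = digits k n t) -> m = n.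
Proof.
elim: k m n => [|k IHk] m n; first by rewrite expn0; lia.
rewrite expnS => hm hn H.
have E : (m %/ 2 = n %/ 2)%N.
  apply: IHk; try lia; move=> t ht.
  by have := H t (ltnW ht); rewrite !digitsS ht.
have := H k (ltnSn k); rewrite !digitsS ltnn eqxx /= => O.
by rewrite (divn_eq m 2) (divn_eq n 2) E !modn2 O.
Qed.

Lemma prefix_val_lt (k : nat) (x : nat -> bool) : (prefix_val k x < 2 ^ k)%N.
Proof. by elim: k => //= k IHk; rewrite expnS; case: (x k); lia. Qed.

Lemma digits_prefix_val (k : nat) (x : nat -> bool) (t : nat) :
  (t < k)%N -> digits k (prefix_val k x) t = x t.
Proof.
elim: k => //= k IHk; rewrite digitsS; case: (ltnP t k) => [h _|h1 h2].
  have -> : ((2 * prefix_val k x + x k) %/ 2 = prefix_val k x)%N by case: (x k); lia.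
  exact: IHk.
have -> : t = k by lia.
by rewrite eqxx oddD mul2n odd_double; case: (x k).
Qed.

Section Walsh.
Variable R : realType.
Implicit Types (x y g : nat -> bool).

(** [W1] takes [n] itself as the number of binary digits; the digits of [n] from position [k] on are
    zero, so any bound [2 ^ k] on [n] gives the same product. *)
Lemma W1_prod (k n : nat) x : (n < 2 ^ k)%N ->
  W1 R n x = \prod_(t < k) (-1) ^+ (x t && odd (n %/ 2 ^ t)).
Proof.
have ext a b : (a <= b)%N -> (n < 2 ^ a)%N ->
    \prod_(t < b) (-1) ^+ (x t && odd (n %/ 2 ^ t)) =
    \prod_(t < a) (-1) ^+ (x t && odd (n %/ 2 ^ t)) :> R.
  move=> le_ab lt_n; rewrite -(subnKC le_ab) big_split_ord /=.
  rewrite [X in _ * X]big1 ?mulr1 // => i _.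
  by rewrite expnD divnMA (divn_small lt_n) div0n andbF.
move=> lt_n; rewrite /W1 expr_sum.
rewrite -(ext k (maxn k n)) ?leq_maxl // -(ext n (maxn k n)) ?leq_maxr //.
exact: ltn_expl.
Qed.

Lemma W1_eq_prefix (k n : nat) x y : (n < 2 ^ k)%N ->
  (forall t, (t < k)%N -> x t = y t) -> W1 R n x = W1 R n y.
Proof.
by move=> lt_n E; rewrite !(W1_prod _ lt_n); apply: eq_bigr => i _; rewrite E.
Qed.

Lemma W1_0 x : W1 R 0 x = 1.
Proof. by rewrite /W1 big_ord0 expr0. Qed.

Lemma W1_1 x : W1 R 1 x = (-1) ^+ x 0%N.
Proof. by rewrite /W1 big_ord1 andbT. Qed.

Lemma W1_cat (k r q : nat) x : (q < 2 ^ k)%N ->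
  W1 R (2 ^ k * r + q) x = W1 R q x * W1 R r (shift k x).
Proof.
move=> lt_q; have lt_r := ltn_expl r (ltnSn 1).
have lt : (2 ^ k * r + q < 2 ^ (k + r))%N.
  by rewrite expnD; apply: (@leq_trans (2 ^ k * r.+1)); rewrite ?leq_mul2l ?lt_r ?orbT //; lia.
rewrite (W1_prod _ lt) (W1_prod _ lt_q) (W1_prod _ lt_r) big_split_ord /=.
congr (_ * _); apply: eq_bigr => i _; first by rewrite odd_div_exp2_low.
by rewrite odd_div_exp2_high.
Qed.

Lemma W1_xor (n : nat) x y : W1 R n (xor x y) = W1 R n x * W1 R n y.
Proof.
rewrite /W1 !expr_sum -big_split /=; apply: eq_bigr => i _.
by rewrite /xor -exprD; case: (x i); case: (y i); case: odd; rewrite //= ?expr0 ?expr1 // expr2 mulN1r opprK.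
Qed.

Lemma normr_W1 (n : nat) x : `|W1 R n x| = 1.
Proof. by rewrite /W1 normrX normrN1 expr1n. Qed.

Lemma W1_digitsS_low (k n m : nat) : (n < 2 ^ k)%N ->
  W1 R n (digits k.+1 m) = W1 R n (digits k (m %/ 2)).
Proof. by move=> h; apply: (W1_eq_prefix h) => t ht; rewrite digitsS ht. Qed.

Lemma W1_digitsS_high (k n m : nat) : (n < 2 ^ k)%N ->
  W1 R (2 ^ k + n) (digits k.+1 m) =
  W1 R n (digits k (m %/ 2)) * (-1) ^+ m.
Proof.
move=> h; rewrite -[X in (X + n)%N]muln1 W1_cat // W1_digitsS_low //.
by rewrite W1_1 /shift addn0 digitsS ltnn eqxx signr_odd.
Qed.

(** Induction on the last digit of [y]: it meets only the top bits [b], [c] of [p], [r], and its two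
    values add up to [1 + (-1) ^+ (b (+) c)], which is 2 or 0. *)
Lemma sum_W1_W1 (k p r : nat) : (p < 2 ^ k)%N -> (r < 2 ^ k)%N ->
  \sum_(y < 2 ^ k) W1 R p (digits k y) * W1 R r (digits k y) =
  (2 ^ k)%:R * (p == r)%:R.
Proof.
elim: k p r => [|k IHk] p r.
  rewrite expn0 !ltnS !leqn0 => /eqP -> /eqP ->.
  by rewrite big_ord1 !W1_0 eqxx !mulr1.
move=> hp hr.
have split F : \sum_(y < 2 ^ k.+1) F (nat_of_ord y) =
    \sum_(y < 2 ^ k) (F (2 * y)%N + F (2 * y + 1)%N) :> R.
  rewrite expnS; elim: (2 ^ k)%N => [|n IHn]; first by rewrite muln0 !big_ord0.
  by rewrite mulnS add2n !big_ord_recr /= IHn -addrA addn1.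
have half q : (q < 2 ^ k.+1)%N -> exists n b, (n < 2 ^ k)%N /\ q = (2 ^ k * nat_of_bool b + n)%N.
  rewrite expnS => hq; case: (ltnP q (2 ^ k)) => h.
    by exists q, false; rewrite muln0.
  by exists (q - 2 ^ k)%N, true; lia.
have ev n (b : bool) m : (n < 2 ^ k)%N ->
    W1 R (2 ^ k * b + n) (digits k.+1 m) = W1 R n (digits k (m %/ 2)) * (-1) ^+ (b && odd m).
  move=> hn; case: b => /=.
    by rewrite muln1 W1_digitsS_high // signr_odd.
  by rewrite muln0 W1_digitsS_low // mulr1.
have [p' [b [hp' Ep]]] := half _ hp; have [r' [c [hr' Er]]] := half _ hr.
rewrite (split (fun y : nat => W1 R p (digits k.+1 y) * W1 R r (digits k.+1 y))) Ep Er.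
transitivity (\sum_(y < 2 ^ k) (1 + (-1) ^+ (b (+) c)) *
     (W1 R p' (digits k y) * W1 R r' (digits k y))).
  apply: eq_bigr => y _; rewrite !ev //.
  have -> : (2 * y %/ 2 = y)%N by lia.
  have -> : ((2 * y + 1) %/ 2 = y)%N by lia.
  rewrite oddD mul2n odd_double /= !andbF !andbT expr0 signr_addb; ring.
rewrite -mulr_sumr IHk // expnS natrM.
have -> : (2 ^ k * b + p' == 2 ^ k * c + r')%N = (b == c) && (p' == r').
  by case: (b); case: (c) => /=; apply/idP/idP; lia.
by case: (b); case: (c) => //=; case: (p' == r'); rewrite /= ?expr0 ?expr1; ring.
Qed.

(** * Dirichlet kernels *)

Definition dirichlet (N : nat) x : R := \sum_(n < N) W1 R n x.

(** Frequencies are grouped in blocks of length [2 ^ k]; block number [i] carries the common factor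
    [W1 R i (shift k x)], and the last block is cut at [q]. *)
Lemma dirichlet_cat (k r q : nat) x : (q <= 2 ^ k)%N ->
  dirichlet (2 ^ k * r + q) x =
  dirichlet (2 ^ k) x * dirichlet r (shift k x) + W1 R r (shift k x) * dirichlet q x.
Proof.
have blk r' q' : (q' <= 2 ^ k)%N ->
    dirichlet (2 ^ k * r' + q') x =
    dirichlet (2 ^ k * r') x + W1 R r' (shift k x) * dirichlet q' x.
  move=> hq; rewrite /dirichlet big_split_ord /=; congr (_ + _).
  rewrite mulr_sumr; apply: eq_bigr => i _.
  by rewrite W1_cat 1?mulrC // (leq_trans _ hq).
move=> hq; rewrite blk //; congr (_ + _).
elim: r => [|r IHr]; first by rewrite muln0 /dirichlet !big_ord0 mulr0.
rewrite mulnSr blk // IHr [dirichlet r.+1 _]/dirichlet big_ord_recr /=.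
rewrite -/(dirichlet r _); ring.
Qed.

Lemma dirichlet_exp2S (k : nat) x :
  dirichlet (2 ^ k.+1) x = dirichlet (2 ^ k) x * (1 + (-1) ^+ x k).
Proof.
have -> : (2 ^ k.+1 = 2 ^ k * 1 + 2 ^ k)%N by rewrite expnS; lia.
rewrite dirichlet_cat // /dirichlet big_ord1 W1_0 W1_1 /shift addn0; ring.
Qed.

Lemma dirichlet_exp2_eq0 (k t : nat) x : (t < k)%N -> x t -> dirichlet (2 ^ k) x = 0.
Proof.
elim: k => // k IHk; rewrite ltnS leq_eqVlt dirichlet_exp2S => /orP[/eqP -> ->|h xt].
  by rewrite expr1 subrr mulr0.
by rewrite IHk ?mul0r.
Qed.

Lemma dirichlet_le (N : nat) x : `|dirichlet N x| <= N%:R.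
Proof.
apply: le_trans (ler_norm_sum _ _ _) _.
rewrite (eq_bigr (fun=> 1)) => [|i _]; last exact: normr_W1.
by rewrite sumr_const card_ord.
Qed.

Lemma dirichlet_eq_prefix (k N : nat) x y : (N <= 2 ^ k)%N ->
  (forall t, (t < k)%N -> x t = y t) -> dirichlet N x = dirichlet N y.
Proof.
move=> hN E; apply: eq_bigr => i _; apply: W1_eq_prefix E.
exact: leq_trans hN.
Qed.

(** A digit 1 before position [k] cancels every complete block of length [2 ^ k]; only the remainder
    of [N] modulo [2 ^ k] is left, whence a bound free of [N]. *)
Lemma dirichlet_le_first (k t N : nat) x : (t < k)%N -> x t ->
  `|dirichlet N x| <= (2 ^ k)%:R.
Proof.
move=> lt xt; rewrite (divn_eq N (2 ^ k)) mulnC.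
have hm := ltn_pmod N (expn_gt0 2 k).
rewrite dirichlet_cat 1?ltnW // (dirichlet_exp2_eq0 lt xt) mul0r add0r.
rewrite normrM normr_W1 mul1r; apply: le_trans (dirichlet_le _ _) _.
by rewrite ler_nat ltnW.
Qed.

(* Only the frequencies [n < N] with [n %/ 2 ^ k = p] survive the summation. *)
Lemma sum_W1_dirichlet (k p N x : nat) g : (p < 2 ^ k)%N -> (N <= 2 ^ (k + k))%N ->
  \sum_(y < 2 ^ k) W1 R p (digits k y) *
     dirichlet N (xor g (digits (k + k) (2 ^ k * x + y))) =
  (2 ^ k)%:R * (W1 R p (shift k g) *
     dirichlet (minn (2 ^ k) (N - 2 ^ k * p)) (xor g (digits k x))).
Proof.
move=> hp hN.
transitivity (\sum_(n < N) W1 R n g * W1 R (n %% 2 ^ k) (digits k x) *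
     ((2 ^ k)%:R * (p == n %/ 2 ^ k)%N%:R)).
  under eq_bigr => y _ do rewrite /dirichlet mulr_sumr.
  rewrite exchange_big /=; apply: eq_bigr => n _.
  have hn : (n %/ 2 ^ k < 2 ^ k)%N.
    by rewrite ltn_divLR ?expn_gt0 // -expnD (leq_trans _ hN).
  have hm := ltn_pmod n (expn_gt0 2 k).
  rewrite -sum_W1_W1 // mulr_sumr; apply: eq_bigr => y _.
  rewrite W1_xor {2}(divn_eq n (2 ^ k)) [(_ %/ _ * _)%N]mulnC W1_cat //.
  rewrite (W1_eq_prefix (y := digits k x) hm) => [|t ht]; last first.
    by rewrite digits_cat // ht.
  rewrite (W1_eq_prefix (y := digits k y) hn) => [|t ht]; last first.
    by rewrite /shift digits_cat // ltnNge leq_addr /= addKn.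
  ring.
rewrite /dirichlet !mulr_sumr.
set c := minn _ _.
have FE a b (F : nat -> R) : (a <= b)%N ->
    \sum_(n < a) F n = \sum_(n < b | (n < a)%N) F n.
  by move=> hab; rewrite (big_ord_widen _ F hab).
rewrite (FE c (2 ^ k)%N (fun i : nat => (2 ^ k)%:R *
  (W1 R p (shift k g) * W1 R i (xor g (digits k x))))) ?geq_minl //.
rewrite (FE N _ (fun n : nat => W1 R n g * W1 R (n %% 2 ^ k) (digits k x) *
     ((2 ^ k)%:R * (p == n %/ 2 ^ k)%N%:R)) hN).
have lt2 (q : 'I_(2 ^ k)) : (2 ^ k * p + q < 2 ^ (k + k))%N.
  rewrite expnD; apply: (@leq_trans (2 ^ k * p.+1)).
    by rewrite mulnS addnC ltn_add2r.
  by rewrite leq_mul2l hp orbT.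
(* The surviving frequencies are [2 ^ k * p + q] with [q < 2 ^ k]; [h] and [h'] pass between such a
   frequency and its low part. *)
pose h (q : 'I_(2 ^ k)) : 'I_(2 ^ (k + k)) := Ordinal (lt2 q).
have mod_lt (n : nat) : (n %% 2 ^ k < 2 ^ k)%N by rewrite ltn_pmod ?expn_gt0.
pose h' (n : 'I_(2 ^ (k + k))) : 'I_(2 ^ k) := Ordinal (mod_lt n).
rewrite (bigID (fun n : 'I_(2 ^ (k + k)) => p == n %/ 2 ^ k)%N) /=.
rewrite [X in _ + X]big1 ?addr0; last by move=> n /andP[_ /negbTE ->]; rewrite !mulr0.
rewrite (reindex_onto h h') /=; last first.
  move=> n /andP[_ /eqP E]; apply: val_inj => /=.
  by rewrite E mulnC -divn_eq.
have divh (q : 'I_(2 ^ k)) : ((2 ^ k * p + q) %/ 2 ^ k)%N = p.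
  by rewrite mulnC divnMDl ?expn_gt0 // divn_small // addn0.
have modh (q : 'I_(2 ^ k)) : ((2 ^ k * p + q) %% 2 ^ k)%N = q.
  by rewrite mulnC modnMDl modn_small.
apply: eq_big => [q|q _].
  rewrite divh eqxx andbT.
  have -> : h' (h q) == q by apply/eqP/val_inj => /=; rewrite modh.
  rewrite andbT /c leq_min ltn_ord /=; lia.
rewrite divh modh eqxx mulr1 W1_xor W1_cat //; ring.
Qed.

End Walsh.

(** * Rectangular and iterated sums *)

Section IteratedSums.
Variables (R : realType) (d : nat).
Implicit Types (f a : ('I_d -> nat) -> R) (n N : 'I_d -> nat) (l : seq 'I_d).

(** The finite analogue of [iter_sum], truncated at [N]; it links [psum] with the iterated
    series. *)
Fixpoint box_sum N l f n : R :=
  if l is j :: l' then \sum_(k < N j) box_sum N l' f (upd n j k) else f n.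

(** Coordinates in [l] run below [N] and the others stay frozen at [n0]; the induction sorts the
    tuples by their value at the head of [l]. *)
Lemma box_sum_ffun (B : nat) N l f n0 :
  uniq l -> (forall j, j \in l -> (N j <= B)%N) -> (forall j, (n0 j < B)%N) ->
  box_sum N l f n0 =
  \sum_(n : {ffun 'I_d -> 'I_B} |
      [forall j, if j \in l then (n j < N j)%N else val (n j) == n0 j])
    f (fun j => val (n j)).
Proof.
elim: l n0 => [|j l IHl] n0 /=.
  move=> _ _ n0B.
  rewrite (big_pred1 [ffun j => Ordinal (n0B j)]) => [|n /=].
    by congr f; apply/funext => j; rewrite ffunE.
  apply/forallP/eqP => [H|-> j]; last by rewrite ffunE.
  by apply/ffunP => j; rewrite ffunE; apply/val_inj/eqP/H.
move=> /andP[jl ul] NB n0B.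
have jin : j \in j :: l by rewrite mem_head.
transitivity (\sum_(k < B | (k < N j)%N) box_sum N l f (upd n0 j k)).
  by rewrite (big_ord_widen _ (fun k => box_sum N l f (upd n0 j k)) (NB j jin)).
rewrite [RHS](partition_big (fun n : {ffun 'I_d -> 'I_B} => n j)
    (fun k : 'I_B => k < N j)%N) /=; last first.
  by move=> n /forallP /(_ j); rewrite jin.
apply: eq_bigr => k kN; rewrite IHl //; last 2 first.
- by move=> i il; apply: NB; rewrite in_cons il orbT.
- by move=> i; rewrite /upd; case: eqP.
apply: eq_bigl => n; apply/forallP/andP => [H|[/forallP H /eqP njk] i].
  have /eqP njk : n j == k.
    by have := H j; rewrite (negbTE jl) /upd eqxx => /eqP /val_inj ->.
  split; last by apply/eqP.
  apply/forallP => i; have := H i; rewrite in_cons /upd.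
  by case: (eqVneq i j) => [->|]; rewrite //= (negbTE jl) njk.
have := H i; rewrite in_cons /upd.
by case: (eqVneq i j) => [->|] //=; rewrite (negbTE jl) njk.
Qed.

Lemma psum_box_sum a N g l :
  perm_eq l (enum 'I_d) -> (0 < \max_(j < d) N j)%N ->
  psum a N g = box_sum N l (fun n => a n * Wv R n g) (fun=> 0%N).
Proof.
move=> pl N0; have ul : uniq l by rewrite (perm_uniq pl) enum_uniq.
rewrite (@box_sum_ffun (\max_(j < d) N j)) //; last first.
  by move=> j _; apply: (leq_bigmax j).
apply: eq_bigl => n; apply: eq_forallb => j.
by rewrite (perm_mem pl) mem_enum.
Qed.

(** The index type of [psum] depends on [N]; a common bound [B] makes partial sums with different
    [N] comparable term by term. *)
Lemma psum_widen (B : nat) a N g :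
  (0 < \max_(j < d) N j)%N -> (forall j, (N j <= B)%N) ->
  psum a N g = \sum_(n : {ffun 'I_d -> 'I_B} | [forall j, (n j < N j)%N])
    a (fun j => val (n j)) * Wv R (fun j => val (n j)) g.
Proof.
move=> N0 NB; rewrite (psum_box_sum _ _ (perm_refl _) N0).
have B0 : (0 < B)%N by apply: leq_trans N0 _; apply/bigmax_leqP.
rewrite (@box_sum_ffun B) ?enum_uniq //.
by apply: eq_bigl => n; apply: eq_forallb => j; rewrite mem_enum.
Qed.

Lemma box_sum_eq0 N l f n0 :
  (forall n, (forall i, i \notin l -> n i = n0 i) -> f n = 0) ->
  box_sum N l f n0 = 0.
Proof.
elim: l n0 => [|j l IHl] n0 H /=; first by apply: H.
apply: big1 => k _; apply: IHl => n En; apply: H => i.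
rewrite in_cons negb_or => /andP[ij il].
by rewrite En // /upd (negbTE ij).
Qed.

Definition supported_in (L : nat) l f n0 :=
  forall n, (forall i, i \notin l -> n i = n0 i) ->
    (exists2 i, i \in l & (L <= n i)%N) -> f n = 0.

Lemma supported_in_upd L j l f n0 k :
  supported_in L (j :: l) f n0 -> supported_in L l f (upd n0 j k).
Proof.
move=> H n En [i il Li]; apply: H; last by exists i; rewrite ?in_cons ?il ?orbT.
move=> i'; rewrite in_cons negb_or => /andP[ij i'l].
by rewrite En // /upd (negbTE ij).
Qed.

Lemma box_sum_upd_eq0 N L j l f n0 k :
  j \notin l -> supported_in L (j :: l) f n0 -> (L <= k)%N ->
  box_sum N l f (upd n0 j k) = 0.
Proof.
move=> jl H Lk; apply: box_sum_eq0 => n En; apply: H.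
  move=> i; rewrite in_cons negb_or => /andP[ij il].
  by rewrite En // /upd (negbTE ij).
by exists j; rewrite ?mem_head // En // /upd eqxx.
Qed.

Lemma sum_ord_stable (L K : nat) (u : nat -> R) :
  (L <= K)%N -> (forall k, (L <= k)%N -> u k = 0) ->
  \sum_(k < K) u k = \sum_(k < L) u k.
Proof.
move=> LK u0; rewrite -(subnKC LK) big_split_ord /= [X in _ + X]big1 ?addr0 //.
by move=> i _; rewrite u0 ?leq_addr.
Qed.

Lemma box_sum_stable N N' L l f n0 :
  uniq l -> supported_in L l f n0 ->
  (forall i, (L <= N i)%N) -> (forall i, (L <= N' i)%N) ->
  box_sum N l f n0 = box_sum N' l f n0.
Proof.
elim: l n0 => //= j l IHl n0 /andP[jl ul] H LN LN'.
rewrite (sum_ord_stable (u := fun k => box_sum N l f (upd n0 j k)) (LN j)); last first.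
  by move=> k; apply: box_sum_upd_eq0 jl H.
rewrite (sum_ord_stable (u := fun k => box_sum N' l f (upd n0 j k)) (LN' j)); last first.
  by move=> k; apply: box_sum_upd_eq0 jl H.
by apply: eq_bigr => k _; apply: IHl => //; apply: supported_in_upd H.
Qed.

Lemma iter_sum_box_sum N L l f n0 :
  uniq l -> supported_in L l f n0 -> (forall i, (L <= N i)%N) ->
  iter_sum l f n0 (box_sum N l f n0).
Proof.
elim: l n0 => //= j l IHl n0 /andP[jl ul] H LN.
exists (fun k => box_sum N l f (upd n0 j k)); split.
  by move=> k; apply: IHl => //; apply: supported_in_upd H.
move=> e e0; exists (N j) => K hK.
rewrite (sum_ord_stable (u := fun k => box_sum N l f (upd n0 j k)) hK).
  by rewrite subrr normr0.
by move=> k /(leq_trans (LN j)); apply: box_sum_upd_eq0 jl H.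
Qed.

(* All inner sums are finite, so that the outer partial sums are rectangular
   partial sums. *)
Lemma cvg_rep_of_rect (c : nat) a g (S : R) l :
  (0 < d)%N -> (forall n i j, a n != 0 -> (n i < c + 2 * n j)%N) ->
  perm_eq l (enum 'I_d) -> cvg_rect a g S -> cvg_rep l a g S.
Proof.
move=> d0 supp pl cv; have ul : uniq l by rewrite (perm_uniq pl) enum_uniq.
have inl i : i \in l by rewrite (perm_mem pl) mem_enum.
case: l pl ul inl => [|j l] pl ul inl.
  by have := perm_size pl; rewrite size_enum_ord /= => d0'; exfalso; lia.
rewrite /cvg_rep /=; set f := fun n => _.
have /andP[jl ul'] : (j \notin l) && uniq l by [].
have suppk k L : (c + 2 * k <= L)%N -> supported_in L l f (upd (fun=> 0%N) j k).
  move=> hL n En [i il Li]; rewrite /f; case: (eqVneq (a n) 0) => [->|an0].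
    by rewrite mul0r.
  have := supp n i j an0; rewrite (En j jl) /upd eqxx => h.
  by have := leq_trans h hL; rewrite ltnNge Li.
exists (fun k => box_sum (fun=> c + 2 * k)%N l f (upd (fun=> 0%N) j k)); split.
  by move=> k; apply: (@iter_sum_box_sum _ (c + 2 * k)) => //; apply: suppk.
move=> e e0; have [K0 HK0] := cv e e0; exists K0.+1 => K hK.
(* The outer variable stops at [K], and [c + 2 * K] exceeds the range [c + 2 * k] of every inner sum
   with [k < K], so this rectangle contains all inner sums completely. *)
pose N i := if i == j then K else (c + 2 * K)%N.
have NK i : (K <= N i)%N by rewrite /N; case: ifP => // _; lia.
have -> : \sum_(k < K) box_sum (fun=> c + 2 * k)%N l f (upd (fun=> 0%N) j k) = psum a N g.
  have N0 : (0 < \max_(i < d) N i)%N.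
    by apply: leq_trans (leq_bigmax j); apply: leq_trans (NK j); lia.
  have NjK : N j = K by rewrite /N eqxx.
  rewrite (psum_box_sum _ _ pl N0) /= NjK; apply: eq_bigr => k _.
  have E M M' : (forall i, i \in l -> M i = M' i) -> forall n0,
      box_sum M l f n0 = box_sum M' l f n0.
    elim: (l) => //= i l' IH EM n0; rewrite EM ?mem_head //.
    by apply: eq_bigr => k' _; apply: IH => i' i'l; apply: EM; rewrite in_cons i'l orbT.
  rewrite (E N (fun=> c + 2 * K)%N) => [|i il]; last first.
    by rewrite /N; case: eqP => // ij; move: jl; rewrite -ij il.
  apply: (@box_sum_stable _ _ (c + 2 * k)) => //; first exact: suppk.
  by move=> _; have := ltn_ord k; lia.
by apply: HK0 => i; apply: leq_trans (NK i); lia.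
Qed.

Lemma cvg_cube_of_rect a g (S : R) : cvg_rect a g S -> cvg_cube a g S.
Proof. by move=> cv e e0; have [K HK] := cv e e0; exists K => N hN; apply: HK. Qed.

End IteratedSums.

(** * Integration against a quasimeasure *)

Lemma sum_indicator_le1 (R : realType) (I : finType) (P : pred I) :
  (forall x y, P x -> P y -> x = y) -> \sum_(x : I) (P x)%:R <= 1 :> R.
Proof.
move=> uP; case: (pickP P) => [x0 Px0|P0]; last first.
  by rewrite big1 // => x _; rewrite P0.
rewrite (bigD1 x0) //= Px0 big1 ?addr0 // => x nx.
by case Px: (P x) => //; rewrite (uP _ _ Px Px0) eqxx in nx.
Qed.

(** * Sums of Dirichlet kernels over the intervals of one rank *)

Section KernelSums.
Variables (R : realType) (k N : nat) (s : {perm 'I_(2 ^ k)}) (g : nat -> bool).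

Let kernel (x : 'I_(2 ^ k)) : R :=
  `|dirichlet R (minn (2 ^ k) (N - 2 ^ k * s x)) (xor g (digits k x))|.

(* Unless [s x] is the quotient [N %/ 2 ^ k], the kernel has order [0] or
   [2 ^ k], hence vanishes off the cube of [g]. *)
Lemma kernel_far (k1 t : nat) (x : 'I_(2 ^ k)) :
  (t < k1)%N -> (k1 <= k)%N -> g t != digits k x t ->
  kernel x <= (2 ^ k1)%:R * (val (s x) == N %/ 2 ^ k)%N%:R.
Proof.
move=> tk1 k1k gt; have xt : xor g (digits k x) t by rewrite /xor addbC -negb_eqb eq_sym.
rewrite /kernel; case: (ltngtP (val (s x)) (N %/ 2 ^ k)%N) => [lt|lt|E] /=.
- have -> : (minn (2 ^ k) (N - 2 ^ k * s x) = 2 ^ k)%N.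
    apply/minn_idPl; rewrite leq_subRL.
      apply: leq_trans (leq_divM N (2 ^ k)).
      by rewrite addnC -mulnS mulnC leq_mul2r lt orbT.
    apply: leq_trans (leq_divM N (2 ^ k)).
    by rewrite mulnC leq_mul2r (ltnW lt) orbT.
  by rewrite (dirichlet_exp2_eq0 _ (leq_trans tk1 k1k) xt) normr0 mulr0.
- have -> : (minn (2 ^ k) (N - 2 ^ k * s x) = 0)%N.
    apply/eqP; rewrite -leqn0 geq_min [X in _ || X]leqn0 subn_eq0; apply/orP; right.
    apply: leq_trans (_ : (N %/ 2 ^ k).+1 * 2 ^ k <= _)%N.
      by rewrite ltnW // ltn_ceil // expn_gt0.
    by rewrite mulnC leq_mul2l lt orbT.
  by rewrite /dirichlet big_ord0 normr0 mulr0.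
by rewrite mulr1; apply: dirichlet_le_first tk1 xt.
Qed.

Lemma sum_perm_eq_le1 (p : nat) : \sum_x (val (s x) == p)%:R <= 1 :> R.
Proof.
apply: sum_indicator_le1 => x y /eqP Ex /eqP Ey.
by apply: (@perm_inj _ s); apply: val_inj; rewrite Ex Ey.
Qed.

(** Since [s] is injective, at most one [x] hits the quotient [N %/ 2 ^ k], so [kernel_far] leaves a
    single term. *)
Lemma sum_kernel_far_le (k1 : nat) : (k1 <= k)%N ->
  \sum_(x : 'I_(2 ^ k) | [exists t : 'I_k1, g t != digits k x t]) kernel x <= (2 ^ k1)%:R.
Proof.
move=> k1k.
apply: le_trans (_ : \sum_x (2 ^ k1)%:R * (val (s x) == N %/ 2 ^ k)%N%:R <= _).
  rewrite big_mkcond /=; apply: ler_sum => x _; case: ifP => [/existsP[t]|_].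
    exact: kernel_far.
  by rewrite mulr_ge0.
by rewrite -mulr_sumr ler_piMr // sum_perm_eq_le1.
Qed.

(** The [x] whose digits differ from those of [g] contribute at most [2 ^ k] by the far bound with
    [k1 = k]; the one remaining [x] contributes at most the order of its kernel. *)
Lemma sum_kernel_le : \sum_x kernel x <= 2 * (2 ^ k)%:R.
Proof.
rewrite (bigID (fun x : 'I_(2 ^ k) => [exists t : 'I_k, g t != digits k x t])) /=.
rewrite mulr_natl mulr2n; apply: lerD; first exact: sum_kernel_far_le.
rewrite big_mkcond /=.
apply: le_trans (_ : \sum_(x < 2 ^ k) (2 ^ k)%:R *
    (~~ [exists t : 'I_k, g t != digits k x t])%:R <= _).
  apply: ler_sum => x _; case: ifP => _; rewrite ?mulr0 // mulr1.
  by apply: le_trans (dirichlet_le _ _ _) _; rewrite ler_nat geq_minl.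
rewrite -mulr_sumr ler_piMr // sum_indicator_le1 // => x y.
rewrite !negb_exists => /forallP Hx /forallP Hy; apply: val_inj.
apply: (digits_inj (ltn_ord x) (ltn_ord y)) => t tk.
have /negPn/eqP <- := Hx (Ordinal tk).
by have /negPn/eqP -> := Hy (Ordinal tk).
Qed.

End KernelSums.

Lemma sum_ffun_mul_add (R : realType) (I : finType) (a b n : nat) (F : (I -> nat) -> R) :
  (0 < b)%N -> n = (a * b)%N ->
  \sum_(m : {ffun I -> 'I_n}) F (fun j => val (m j)) =
  \sum_(m1 : {ffun I -> 'I_a}) \sum_(m2 : {ffun I -> 'I_b})
     F (fun j => b * m1 j + m2 j)%N.
Proof.
move=> b0 ->; rewrite pair_big /=.
have lt (i : 'I_a) (j : 'I_b) : (b * i + j < a * b)%N.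
  apply: (@leq_trans (b * i.+1)); first by rewrite mulnS addnC ltn_add2r.
  by rewrite [(a * b)%N]mulnC leq_mul2l ltn_ord orbT.
have ltd (i : 'I_(a * b)) : (i %/ b < a)%N by rewrite ltn_divLR.
have ltm (i : 'I_(a * b)) : (i %% b < b)%N by rewrite ltn_pmod.
pose h (p : {ffun I -> 'I_a} * {ffun I -> 'I_b}) : {ffun I -> 'I_(a * b)} :=
  [ffun j => Ordinal (lt (p.1 j) (p.2 j))].
pose h' (m : {ffun I -> 'I_(a * b)}) : {ffun I -> 'I_a} * {ffun I -> 'I_b} :=
  ([ffun j => Ordinal (ltd (m j))], [ffun j => Ordinal (ltm (m j))]).
rewrite (reindex h) /=.
  apply: eq_bigr => p _; congr F; apply/funext => j.
  by rewrite ffunE.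
exists h' => [p _|m _].
  rewrite /h' /h; case: p => p1 p2 /=; congr (_, _); apply/ffunP => j;
    rewrite !ffunE; apply: val_inj => /=.
    by rewrite mulnC divnMDl // divn_small // addn0.
  by rewrite mulnC modnMDl modn_small.
by apply/ffunP => j; rewrite !ffunE; apply: val_inj; rewrite /= mulnC -divn_eq.
Qed.

(** * Refinement of the rank, Fourier coefficients, and partial sums as integrals *)

Section Quasimeasures.
Variables (R : realType) (d : nat).
Implicit Types (tau e : nat -> ('I_d -> nat) -> R).

Definition qint tau (k : nat) (f : 'I_d -> nat -> R) : R :=
  \sum_(m : {ffun 'I_d -> 'I_(2 ^ k)})
    tau k (fun j => val (m j)) * \prod_(l < d) f l (m l).

(** The density [2 ^+ (d * k) * tau k] is multiplied by [1 + e k * R_k] when the rank grows by one: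
    the parity of [x l] is the new digit in coordinate [l]. *)
Definition riesz_step tau e (k : nat) : Prop := forall x : 'I_d -> nat,
  tau k.+1 x = tau k (fun j => x j %/ 2)%N *
    (1 + e k (fun j => x j %/ 2)%N * \prod_(l < d) (-1) ^+ x l) / 2 ^+ d.

Lemma eq_qint tau k (f f' : 'I_d -> nat -> R) :
  (forall l x, (x < 2 ^ k)%N -> f l x = f' l x) -> qint tau k f = qint tau k f'.
Proof.
by move=> E; apply: eq_bigr => m _; congr (_ * _); apply: eq_bigr => l _; rewrite E.
Qed.

(** Summing over the children of a cube, the constant 1 produces the mean over the new digit in each
    coordinate, and the Rademacher product produces the half difference. *)
Lemma qintS tau e k f : riesz_step tau e k ->
  qint tau k.+1 f =
  qint tau k (fun l x => (f l (2 * x)%N + f l (2 * x + 1)%N) / 2) +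
  qint (fun k x => tau k x * e k x) k
    (fun l x => (f l (2 * x)%N - f l (2 * x + 1)%N) / 2).
Proof.
move=> st; rewrite /qint.
pose F (m : 'I_d -> nat) := tau k.+1 m * \prod_(l < d) f l (m l).
rewrite (sum_ffun_mul_add F (isT : 0 < 2)%N (expnSr 2 k)).
rewrite -big_split /=; apply: eq_bigr => m _; rewrite /F.
have Ed : (2 : R) ^+ d != 0 by rewrite expf_neq0 ?pnatr_eq0.
(* The weight [c = 1] gives the means and [c i = (-1) ^+ i] the half differences. *)
pose Dm (c : nat -> R) := \prod_(l < d) ((c 0%N * f l (2 * m l)%N + c 1%N * f l (2 * m l + 1)%N) / 2).
have distr2 (c : nat -> R) : \sum_(s : {ffun 'I_d -> 'I_2}) \prod_(l < d) (c (s l) * f l (2 * m l + s l)%N / 2) = Dm c.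
  rewrite /Dm -(bigA_distr_bigA (fun l (i : 'I_2) => c i * f l (2 * m l + i)%N / 2)) /=.
  by apply: eq_bigr => l _; rewrite big_ord_recl big_ord1 /= addn0 mulrDl.
pose mm j := val (m j).
transitivity (tau k mm * Dm (fun=> 1) + tau k mm * e k mm * Dm (fun i => (-1) ^+ i)); last first.
  by congr (_ * _ + _ * _); apply: eq_bigr => l _; rewrite ?mul1r ?expr0 ?expr1 ?mulN1r.
rewrite -!distr2 !mulr_sumr -big_split /=; apply: eq_bigr => s _.
rewrite st.
have -> : (fun j => (2 * m j + s j) %/ 2)%N = mm.
  by apply/funext => j; rewrite /mm /=; have := ltn_ord (s j); lia.
have -> : \prod_(l < d) (-1) ^+ (2 * m l + s l) = \prod_(l < d) (-1) ^+ s l :> R.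
  by apply: eq_bigr => l _; rewrite exprD exprM sqrrN !expr1n mul1r.
rewrite !big_split /= !prodr_const card_ord expr1n exprVn.
by field.
Qed.

Definition coef tau k (n : 'I_d -> nat) : R :=
  qint tau k (fun l x => W1 R (n l) (digits k x)).

Lemma genE tau n : gen tau n = coef tau (\max_(j < d) n j) n.
Proof. by apply: eq_bigr => m _; rewrite mulrC. Qed.

Lemma coefS_low tau e k n : riesz_step tau e k -> (0 < d)%N ->
  (forall j, (n j < 2 ^ k)%N) -> coef tau k.+1 n = coef tau k n.
Proof.
move=> st d0 hn; rewrite /coef (qintS _ st) [X in _ + X]big1 ?addr0.
  apply: eq_qint => l x _; rewrite !W1_digitsS_low //.
  have -> : (2 * x %/ 2 = x)%N by lia.
  have -> : ((2 * x + 1) %/ 2 = x)%N by lia.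
  by field.
move=> m _; rewrite (bigD1 (Ordinal d0)) //= !W1_digitsS_low //.
have -> : (2 * m (Ordinal d0) %/ 2 = (2 * m (Ordinal d0) + 1) %/ 2)%N by lia.
by rewrite subrr mul0r mul0r mulr0.
Qed.

(** A coordinate with top bit has mean zero and one without top bit has difference zero, so a new
    frequency survives only when all coordinates carry the top bit and [e k] is not identically
    zero. *)
Lemma coefS_eq0 tau e k n i : riesz_step tau e k ->
  (forall j, (n j < 2 ^ k.+1)%N) -> (2 ^ k <= n i)%N ->
  ((forall x, e k x = 0) \/ exists j, (n j < 2 ^ k)%N) -> coef tau k.+1 n = 0.
Proof.
move=> st hn hi H; rewrite /coef (qintS _ st) [X in X + _]big1 ?add0r.
  apply: big1 => m _; case: H => [-> |[j hj]]; first by rewrite mulr0 mul0r.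
  rewrite (bigD1 j) //= !W1_digitsS_low //.
  have -> : (2 * m j %/ 2 = (2 * m j + 1) %/ 2)%N by lia.
  by rewrite subrr mul0r mul0r mulr0.
move=> m _; rewrite (bigD1 i) //=.
have lt : (n i - 2 ^ k < 2 ^ k)%N by have := hn i; rewrite expnS; lia.
rewrite -(subnKC hi) !W1_digitsS_high //.
have -> : (2 * m i %/ 2 = (2 * m i + 1) %/ 2)%N by lia.
by rewrite exprD expr1 mulrN1 mulrN subrr mul0r mul0r mulr0.
Qed.

(** By [W1_xor] the partial sum is the convolution of [tau] with a product of Dirichlet kernels. *)
Lemma psum_qint tau (a : ('I_d -> nat) -> R) k N g :
  (0 < d)%N -> (forall j, (0 < N j <= 2 ^ k)%N) ->
  (forall n, (forall j, (n j < 2 ^ k)%N) -> a n = coef tau k n) ->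
  psum a N g = qint tau k (fun l x => dirichlet R (N l) (xor (g l) (digits k x))).
Proof.
move=> d0 hN ha.
rewrite (@psum_widen R d (2 ^ k)); first last.
- by move=> j; case/andP: (hN j).
- by apply: leq_trans (leq_bigmax (Ordinal d0)); case/andP: (hN (Ordinal d0)).
under eq_bigr => n _ do rewrite (ha _ (fun j => ltn_ord (n j))) /coef /qint mulr_suml.
rewrite exchange_big /=; apply: eq_bigr => m _.
under eq_bigr => n _ do rewrite -mulrA -big_split /=.
rewrite -mulr_sumr; congr (_ * _).
transitivity (\prod_(l < d) \sum_(i < 2 ^ k | (i < N l)%N)
    W1 R i (xor (g l) (digits k (m l)))); last first.
  apply: eq_bigr => l _; rewrite /dirichlet.
  have /andP[_ h] := hN l.
  by rewrite (big_ord_widen _ (fun i => W1 R i (xor (g l) (digits k (m l)))) h).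
rewrite bigA_distr_big_dep /=; apply: eq_big => [n|n _].
  by apply/forallP/familyP.
by apply: eq_bigr => l _; rewrite W1_xor mulrC.
Qed.

End Quasimeasures.

(** * The set F and its quasimeasure *)

Lemma mseq_ltn i j : (i < j)%N -> (4 * mseq i + 2 <= mseq j)%N.
Proof.
elim: j => // j IHj; rewrite ltnS leq_eqVlt => /orP[/eqP -> /=|/IHj /=]; lia.
Qed.

Lemma mseq_ge i : (2 * i <= mseq i)%N.
Proof. elim: i => //= i; lia. Qed.

Lemma mseq_inj i j : (2 * mseq i = 2 * mseq j)%N -> i = j.
Proof. by case: (ltngtP i j) => // /mseq_ltn; lia. Qed.

Lemma prefix_val_eq (k : nat) (y z : nat -> bool) :
  (forall t, (t < k)%N -> y t = z t) -> prefix_val k y = prefix_val k z.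
Proof.
by elim: k => //= k IHk E; rewrite E // IHk // => t tk; apply: E; apply: ltnW.
Qed.

Definition prefix_ord (k : nat) (y : nat -> bool) : 'I_(2 ^ k) :=
  Ordinal (prefix_val_lt k y).

Lemma prefix_ord_eq (k : nat) (y z : nat -> bool) :
  (forall t, (t < k)%N -> y t = z t) -> prefix_ord k y = prefix_ord k z.
Proof. by move=> E; apply: val_inj; apply: prefix_val_eq. Qed.

Lemma prefix_ord_digits (k : nat) (m : 'I_(2 ^ k)) : prefix_ord k (digits k m) = m.
Proof.
apply: val_inj; apply: (digits_inj (ltn_ord _) (ltn_ord m)) => t tk.
exact: digits_prefix_val.
Qed.

Section SupportSet.
Variables (R : realType) (d : nat) (pi : forall i : nat, 'I_d -> {perm 'I_(2 ^ mseq i)}).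
Implicit Types (g h : pt d) (x : 'I_d -> nat).

Lemma prodr_sign (n : 'I_d -> nat) :
  exists b : bool, \prod_(l < d) (-1) ^+ n l = (-1) ^+ b :> R.
Proof.
exists (odd (\sum_(l < d) n l)); rewrite signr_odd.
by elim/big_rec2: _ => [|l m p _ ->]; rewrite ?expr0 ?exprD.
Qed.

(* The unimodular function [W^{(m_s)}_{pi_s(m) m'}] as a function of the point. *)
Definition Psi i g : R :=
  \prod_(l < d) W1 R (pi i l (prefix_ord (mseq i) (g l))) (shift (mseq i) (g l)).

Lemma Psi_sign i g : exists b : bool, Psi i g = (-1) ^+ b.
Proof. exact: prodr_sign. Qed.

Lemma Psi_eq i g h :
  (forall l t, (t < 2 * mseq i)%N -> g l t = h l t) -> Psi i g = Psi i h.
Proof.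
move=> E; apply: eq_bigr => l _.
rewrite (@prefix_ord_eq _ (g l) (h l)) => [|t tm]; last by apply: E; lia.
by apply: W1_eq_prefix => // t tm; apply: E; lia.
Qed.

Lemma RadE k g : Rad R k g = \prod_(l < d) (-1) ^+ g l k.
Proof.
apply: eq_bigr => l _; have := @W1_cat R k 1 0 (g l) (expn_gt0 2 k).
by rewrite muln1 addn0 W1_0 mul1r W1_1 /shift addn0.
Qed.

Lemma Psi_cube i (m m' : 'I_d -> 'I_(2 ^ mseq i)) g :
  cube (2 * mseq i) (fun j => 2 ^ mseq i * m j + m' j)%N g ->
  Wk R (mseq i) (fun j => val (pi i j (m j))) (fun j => val (m' j)) = Psi i g.
Proof.
move=> C; apply: eq_bigr => l _.
have gl t : (t < 2 * mseq i)%N ->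
    g l t = if (t < mseq i)%N then digits (mseq i) (m l) t
            else digits (mseq i) (m' l) (t - mseq i).
  by move=> tm; rewrite -digits_cat // addnn -mul2n C // /digits tm.
rewrite (@prefix_ord_eq _ (g l) (digits (mseq i) (m l))) => [|t tm].
  rewrite prefix_ord_digits; apply: (@W1_eq_prefix R (mseq i)) => [|t tm].
    exact: ltn_ord.
  by rewrite /shift gl ?[X in if X then _ else _]ltnNge ?leq_addr ?addKn //=; lia.
by rewrite gl ?tm //; lia.
Qed.

(** The indices [m] and [m'] are read off from the point, so membership is a parity condition on the
    digits at position [2 * mseq i], given the earlier digits. *)
Lemma FsE i g : Fs R pi i g <-> \prod_(l < d) (-1) ^+ g l (2 * mseq i)%N = Psi i g.
Proof.
rewrite -RadE; split=> [[m [m' [C ->]]]|E]; first exact: Psi_cube.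
pose m j := prefix_ord (mseq i) (g j).
pose m' j := prefix_ord (mseq i) (shift (mseq i) (g j)).
have C : cube (2 * mseq i) (fun j => 2 ^ mseq i * m j + m' j)%N g.
  move=> j t tm.
  transitivity (digits (2 * mseq i) (2 ^ mseq i * m j + m' j) t); last by rewrite /digits tm.
  rewrite mul2n -addnn digits_cat //; case: ltnP => h.
    by rewrite digits_prefix_val.
  by rewrite digits_prefix_val /shift ?subnKC //; lia.
by exists m, m'; rewrite (Psi_cube C).
Qed.

Lemma Fs_eq i g h : (forall l t, (t < (2 * mseq i).+1)%N -> g l t = h l t) ->
  Fs R pi i g -> Fs R pi i h.
Proof.
move=> E; rewrite !FsE (@Psi_eq i g h) => [<-|l t tm]; last by apply: E; lia.
by apply: eq_bigr => l _; rewrite E.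
Qed.

Lemma cube_pt_in (k : nat) x : cube k x (cube_pt k x).
Proof. by move=> j t tk; rewrite /cube_pt tk. Qed.

Lemma cubeE (k : nat) x g :
  cube k x g <-> forall l t, (t < k)%N -> g l t = cube_pt k x l t.
Proof.
split=> H l t tk; first by rewrite (H l t tk) /cube_pt tk.
by rewrite (H l t tk) /cube_pt tk.
Qed.

Lemma cube_ptS_low (k : nat) x l t : (t < k)%N ->
  cube_pt k.+1 x l t = cube_pt k (fun j => x j %/ 2)%N l t.
Proof. by move=> tk; have := digitsS k (x l) t; rewrite tk. Qed.

Lemma cube_ptS_last (k : nat) x l : cube_pt k.+1 x l k = odd (x l).
Proof. by have := digitsS k (x l) k; rewrite ltnn eqxx. Qed.

(** Equals [Psi i] on the cube if [k] is some [2 * mseq i], and 0 at all other ranks: at most one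
    index fits, and it satisfies [i <= k]. *)
Definition riesz_factor (k : nat) x : R :=
  \sum_(i < k.+1 | k == (2 * mseq i)%N) Psi i (cube_pt k x).

Lemma riesz_factor_mseq i x :
  riesz_factor (2 * mseq i) x = Psi i (cube_pt (2 * mseq i) x).
Proof.
have lti : (i < (2 * mseq i).+1)%N by have := mseq_ge i; lia.
rewrite /riesz_factor (big_pred1 (Ordinal lti)) // => j /=.
apply/eqP/eqP => [E|->] //; apply: val_inj => /=.
by apply: mseq_inj.
Qed.

Lemma riesz_factor_eq0 k x : (forall i, k <> 2 * mseq i)%N -> riesz_factor k x = 0.
Proof. by move=> H; apply: big1 => i /eqP; case/H. Qed.

Lemma normr_riesz_factor k x : `|riesz_factor k x| <= (~~ odd k)%:R.
Proof.
have [[i ->]|ne] := pselect (exists i, k = (2 * mseq i)%N); last first.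
  rewrite riesz_factor_eq0 ?normr0 // => i ki; apply: ne; by exists i.
rewrite riesz_factor_mseq; have [b ->] := Psi_sign i (cube_pt (2 * mseq i) x).
by rewrite normr_sign mul2n odd_double.
Qed.

Hypothesis d_gt0 : (0 < d)%N.

Lemma Fpi_extend_step (t : nat) h : exists h' : pt d,
  (forall l u, (u < t)%N -> h' l u = h l u) /\
  (forall i, t = (2 * mseq i)%N -> Fs R pi i h').
Proof.
have [[i Ei]|ne] := pselect (exists i, t = (2 * mseq i)%N); last first.
  by exists h; split=> // i Ei; case: ne; exists i.
pose j0 := Ordinal d_gt0.
have [b Eb] := Psi_sign i h.
have [c Ec] := prodr_sign (fun l => if l == j0 then 0%N else nat_of_bool (h l t)).
(* Only digit [t] of coordinate [j0] changes. As [c] is the sign of the other coordinates there, the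
   digit [b (+) c] gives the total sign [b], and [Psi i] looks only at earlier digits. *)
pose h' : pt d := fun l u => if (u == t) && (l == j0) then b (+) c else h l u.
have h'E l u : (u < t)%N -> h' l u = h l u by rewrite /h'; case: eqP => // ->; rewrite ltnn.
exists h'; split=> // i' Ei'; have -> : i' = i by apply: mseq_inj; rewrite -Ei -Ei'.
rewrite FsE (@Psi_eq i h' h); last by move=> l u; rewrite -Ei; apply: h'E.
rewrite Eb -Ei.
have -> : \prod_(l < d) (-1) ^+ h' l t = (-1) ^+ (b (+) c) *
    \prod_(l < d) (-1) ^+ (if l == j0 then 0%N else nat_of_bool (h l t)) :> R.
  rewrite (bigD1 j0) //= {1}/h' !eqxx /=; congr (_ * _).
  rewrite [RHS](bigD1 j0) //= expr0 mul1r; apply: eq_bigr => l lj.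
  by rewrite /h' (negbTE lj) andbF.
by rewrite Ec !signr_addb -mulrA -signr_addb addbb mulr1.
Qed.

(** The remaining conditions concern distinct later positions, so they can be met one position at a
    time. *)
Lemma Fpi_extend (k : nat) h :
  (forall i, (2 * mseq i < k)%N -> Fs R pi i h) ->
  exists g, (forall l t, (t < k)%N -> g l t = h l t) /\ Fpi R pi g.
Proof.
move=> Hh; have /choice[f Hf] := fun p : nat * pt d => Fpi_extend_step p.1 p.2.
pose u := fix u n := if n is n'.+1 then f ((k + n')%N, u n') else h.
have uD n j l t : (t < k + n)%N -> u (n + j)%N l t = u n l t.
  move=> tn; elim: j => [|j IHj]; first by rewrite addn0.
  rewrite addnS -IHj /=; have [/= H _] := Hf ((k + (n + j))%N, u (n + j)%N).
  by apply: H; lia.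
(* The digits of [u n] before position [k + n] never change again, hence [u t.+1] already carries
   the final digit at [t]. *)
pose g : pt d := fun l t => u t.+1 l t.
have gu n l t : (t < k + n)%N -> g l t = u n l t.
  move=> tn; rewrite /g; case: (leqP n t.+1) => h1.
    by rewrite -(subnKC h1) uD.
  by rewrite -(subnKC (ltnW h1)) uD //; lia.
exists g; split=> [l t tk|i]; first by rewrite (gu 0%N) // addn0.
case: (ltnP (2 * mseq i) k) => hi.
  apply: Fs_eq (Hh i hi) => l t ti; rewrite (gu 0%N) // addn0; lia.
have [_ /= H] := Hf ((k + (2 * mseq i - k))%N, u (2 * mseq i - k)%N).
apply: (@Fs_eq i (u (2 * mseq i - k).+1)) => [l t ti|].
  by rewrite (gu (2 * mseq i - k).+1) //; lia.
by apply: H; lia.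
Qed.

Lemma meets_FpiE (k : nat) x : meets (cube k x) (Fpi R pi) <->
  forall i, (2 * mseq i < k)%N -> Fs R pi i (cube_pt k x).
Proof.
split=> [[g [/cubeE C F]] i ik|/Fpi_extend[g [C F]]].
  by apply: Fs_eq (F i) => l t ti; apply: C; lia.
by exists g; split=> //; apply/cubeE.
Qed.

Lemma meets_FpiS (k : nat) x : meets (cube k.+1 x) (Fpi R pi) <->
  meets (cube k (fun j => x j %/ 2)%N) (Fpi R pi) /\
  forall i, k = (2 * mseq i)%N ->
    \prod_(l < d) (-1) ^+ x l = Psi i (cube_pt k (fun j => x j %/ 2)%N).
Proof.
have PE i : k = (2 * mseq i)%N -> Fs R pi i (cube_pt k.+1 x) <->
    \prod_(l < d) (-1) ^+ x l = Psi i (cube_pt k (fun j => x j %/ 2)%N).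
  move=> ki; rewrite FsE -ki.
  rewrite (@Psi_eq i _ (cube_pt k (fun j => x j %/ 2)%N)); last first.
    by move=> l t; rewrite -ki; apply: cube_ptS_low.
  by under eq_bigr => l _ do rewrite cube_ptS_last signr_odd.
rewrite !meets_FpiE; split=> [H|[H1 H2] i].
  split=> i ik; last by apply/PE => //; apply: H; rewrite -ik.
  apply: Fs_eq (H i (ltnW ik)) => l t ti; apply: cube_ptS_low; lia.
rewrite ltnS leq_eqVlt => /orP[/eqP ki|ik]; first by apply/PE => //; apply: H2.
by apply: Fs_eq (H1 i ik) => l t ti; rewrite cube_ptS_low //; lia.
Qed.

(** * The quasimeasure of F as a Riesz product *)

Lemma card_prodr_sign (b : bool) :
  (#|[set s : {ffun 'I_d -> bool} | \prod_(l < d) (-1) ^+ (s l) == (-1) ^+ b :> R]|)%:R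
    = 2 ^+ d / 2 :> R.
Proof.
set A := [set s | _].
have E : \sum_(s : {ffun 'I_d -> bool}) (1 + (-1) ^+ b * \prod_(l < d) (-1) ^+ (s l))
    = (#|A|)%:R * 2 :> R.
  rewrite (bigID (mem A)) /= [X in _ + X]big1 ?addr0 => [|s].
    rewrite (eq_bigr (fun=> 2)) => [|s]; first by rewrite sumr_const mulr_natl.
    by rewrite inE => /eqP ->; rewrite -signr_addb addbb expr0.
  rewrite inE; have [c ->] := prodr_sign (fun l => nat_of_bool (s l)).
  by rewrite (inj_eq signr_inj); case: b A; case: c => //= A _; rewrite ?expr0 ?expr1; ring.
have S0 : \sum_(s : {ffun 'I_d -> bool}) \prod_(l < d) (-1) ^+ (s l) = 0 :> R.
  rewrite -(bigA_distr_bigA (fun l (c : bool) => (-1) ^+ c)) /=.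
  by rewrite (bigD1 (Ordinal d_gt0)) //= big_bool /= expr0 expr1 addNr mul0r.
move: E; rewrite big_split /= -mulr_sumr S0 mulr0 addr0 sumr_const.
by rewrite card_ffun card_bool card_ord natrX => ->; field.
Qed.

Lemma tauE_eq0 (k : nat) x : ~ meets (cube k x) (Fpi R pi) ->
  tauE R (Fpi R pi) k x = 0.
Proof.
case: k => [|k] H /=; last by rewrite asboolF.
by case: H; apply/meets_FpiE.
Qed.

(** At a rank [2 * mseq i] exactly half of the children of a cube meeting F meet F again, those
    whose sign equals [Psi i], so each share doubles; at the other ranks all children do. *)
Lemma tauE_riesz_step (k : nat) : riesz_step (tauE R (Fpi R pi)) riesz_factor k.
Proof.
move=> x; set y := fun j => _.
have [My|nMy] := pselect (meets (cube k y) (Fpi R pi)); last first.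
  by rewrite [in RHS]tauE_eq0 // tauE_eq0 ?mul0r // => /meets_FpiS[].
have half (s : {ffun 'I_d -> bool}) : (fun j => (2 * (x j %/ 2) + s j) %/ 2)%N = y.
  by apply/funext => j; rewrite /y; case: (s j); lia.
have [q Eq] := prodr_sign x; rewrite Eq.
have sgn (s : {ffun 'I_d -> bool}) :
    \prod_(l < d) (-1) ^+ (2 * (x l %/ 2) + s l) = \prod_(l < d) (-1) ^+ s l :> R.
  by apply: eq_bigr => l _; rewrite exprD exprM sqrrN !expr1n mul1r.
have n2d : (2 : R) ^+ d != 0 by rewrite expf_neq0 ?pnatr_eq0.
have [[i ki]|ne] := pselect (exists i, k = (2 * mseq i)%N); last first.
  have nek i : k <> (2 * mseq i)%N by move=> ki; apply: ne; exists i.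
  rewrite riesz_factor_eq0 // mul0r addr0 mulr1 /= asboolT; last first.
    by apply/meets_FpiS; split=> // i /nek.
  congr (_ / _); set A := [set s | _].
  have -> : A = [set: {ffun 'I_d -> bool}].
    apply/setP => s; rewrite !inE; apply/asboolP/meets_FpiS; rewrite half.
    by split=> // i /nek.
  by rewrite cardsT card_ffun card_bool card_ord natrX.
have [b Eb] := Psi_sign i (cube_pt k y).
have Mch z : (fun j => z j %/ 2)%N = y ->
    meets (cube k.+1 z) (Fpi R pi) <-> \prod_(l < d) (-1) ^+ z l = (-1) ^+ b :> R.
  move=> zy; rewrite meets_FpiS zy; split=> [[_ /(_ i ki)]|E]; first by rewrite Eb.
  by split=> // i' ki'; have -> : i' = i; [apply: mseq_inj; rewrite -ki -ki' | rewrite Eb].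
have -> : riesz_factor k y = (-1) ^+ b by rewrite -Eb ki riesz_factor_mseq.
rewrite /= -/y; set A := [set s | _].
have -> : A = [set s : {ffun 'I_d -> bool} | \prod_(l < d) (-1) ^+ (s l) == (-1) ^+ b :> R].
  apply/setP => s; rewrite !inE; apply/asboolP/eqP; rewrite Mch ?half ?sgn //.
rewrite card_prodr_sign; case: asboolP; rewrite Mch // Eq => Hb.
  rewrite Hb -signr_addb addbb expr0; field; rewrite n2d; lra.
have : q != b by apply/eqP => E; apply: Hb; rewrite E.
by case: q b {Eq Eb Mch A Hb} => [] [] //= _; rewrite ?expr0 ?expr1; ring.
Qed.

Lemma tauE_gt0 (k : nat) x : meets (cube k x) (Fpi R pi) ->
  0 < tauE R (Fpi R pi) k x.
Proof.
elim: k x => [|k IHk] x M /=; first exact: ltr01.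
rewrite asboolT // divr_gt0 ?IHk //; first by case/meets_FpiS: M.
rewrite ltr0n; apply/card_gt0P; exists [ffun j => odd (x j)].
rewrite inE; apply/asboolP.
suff -> : (fun j => 2 * (x j %/ 2) + [ffun j => odd (x j)] j)%N = x by [].
by apply/funext => j; rewrite ffunE; lia.
Qed.

(** A factor exceeds 1 only at even ranks, where it is at most 2, and there are [uphalf k] even
    ranks below [k]. *)
Lemma normr_tauE (k : nat) x :
  `|tauE R (Fpi R pi) k x| <= 2 ^+ uphalf k / 2 ^+ (d * k).
Proof.
elim: k x => [|k IHk] x; first by rewrite muln0 /= normr1 expr0 divr1.
rewrite tauE_riesz_step; set y := fun j => _; have [q ->] := prodr_sign x.
rewrite !normrM normfV [`|2 ^+ d|]ger0_norm ?exprn_ge0 // mulnS exprD invfM.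
have -> : uphalf k.+1 = (uphalf k + ~~ odd k)%N.
  by rewrite !uphalf_half /=; lia.
rewrite exprD [leRHS](_ : _ = 2 ^+ uphalf k / 2 ^+ (d * k) * 2 ^+ (~~ odd k) / 2 ^+ d); last by ring.
rewrite ler_wpM2r ?invr_ge0 ?exprn_ge0 //; apply: ler_pM => //.
apply: le_trans (ler_normD _ _) _; rewrite normr1 normrM normr_sign mulr1.
by have := normr_riesz_factor k y; case: odd => /= h; rewrite ?expr0 ?expr1; lra.
Qed.

End SupportSet.

(** * Convergence of the Riesz product *)

Lemma dirichlet_digitsS (R : realType) (k N x : nat) (g : nat -> bool) :
  (2 ^ k <= N <= 2 ^ k.+1)%N ->
  dirichlet R N (xor g (digits k.+1 x)) =
  dirichlet R (2 ^ k) (xor g (digits k (x %/ 2))) +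
  (-1) ^+ x * ((-1) ^+ g k * dirichlet R (N - 2 ^ k) (xor g (digits k (x %/ 2)))).
Proof.
move=> /andP[N1 N2].
have le : (N - 2 ^ k <= 2 ^ k)%N by move: N2; rewrite expnS; lia.
rewrite -{1}(subnKC N1) -[X in (X + _)%N]muln1 dirichlet_cat //.
have E t : (t < k)%N -> xor g (digits k.+1 x) t = xor g (digits k (x %/ 2)) t.
  by move=> tk; rewrite /xor digitsS tk.
rewrite (dirichlet_eq_prefix _ (leqnn _) E) (dirichlet_eq_prefix _ le E).
rewrite [dirichlet R 1 _]/dirichlet big_ord1 W1_0 mulr1 W1_1 /shift addn0 /xor.
by rewrite digitsS ltnn eqxx /= signr_addb signr_odd; ring.
Qed.

Section RieszProduct.
Variables (R : realType) (d : nat) (pi : forall i : nat, 'I_d -> {perm 'I_(2 ^ mseq i)}).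
Variables (tau : nat -> ('I_d -> nat) -> R) (a : ('I_d -> nat) -> R) (k0 : nat).
Hypothesis d_gt0 : (0 < d)%N.
Hypothesis tau_step : forall k, (k0 <= k)%N -> riesz_step tau (riesz_factor R pi) k.
Hypothesis tau_le : forall k x, (k0 <= k)%N -> `|tau k x| <= 2 ^+ uphalf k / 2 ^+ (d * k).
Hypothesis aE : forall k n, (forall j, (n j < 2 ^ k)%N) -> a n = coef tau k n.

(** Descent on the rank: either all coordinates fit below [2 ^ k], or [coefS_eq0] forces [k] to be
    some [2 * mseq i] and every coordinate to have the top bit [2 ^ k]. *)
Lemma spectrum n : a n != 0 ->
  (forall j, (n j < 2 ^ k0)%N) \/
  exists i, (k0 <= 2 * mseq i)%N /\
    forall j, (2 ^ (2 * mseq i) <= n j < 2 ^ (2 * mseq i).+1)%N.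
Proof.
move=> an0.
have : forall j, (n j < 2 ^ (\max_(j < d) n j))%N.
  by move=> j; apply: leq_ltn_trans (leq_bigmax j) (ltn_expl _ _).
elim: (\max_(j < d) n j) => [|k IHk] hn.
  by left=> j; apply: leq_trans (hn j) _; rewrite leq_exp2l.
case: (leqP k.+1 k0) => [kk0|k0k].
  by left=> j; apply: leq_trans (hn j) _; rewrite leq_exp2l.
have [lt|] := boolP [forall j, (n j < 2 ^ k)%N]; first by apply: IHk; apply/forallP.
rewrite negb_forall => /existsP[j0]; rewrite -leqNgt => hj0.
have st := tau_step k0k; move: an0; rewrite (aE hn) => cn0; right.
have [[i ki]|ne] := pselect (exists i, k = (2 * mseq i)%N); last first.
  case/eqP: cn0; apply: (coefS_eq0 st hn hj0); left=> x.
  by apply: riesz_factor_eq0 => i ki; apply: ne; exists i.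
exists i; rewrite -ki; split=> // j; rewrite hn andbT leqNgt; apply/negP => nj.
by case/eqP: cn0; apply: (coefS_eq0 st hn hj0); right; exists j.
Qed.

(** Coordinates in one diagonal block differ by a factor below 2, and the box costs [2 ^ k0]; this
    is the support condition of [cvg_rep_of_rect]. *)
Lemma spectrum_diag n i j : a n != 0 -> (n i < 2 ^ k0 + 2 * n j)%N.
Proof.
case/spectrum => [/(_ i)|[s [_ H]]]; first by lia.
by have := H i; have := H j; rewrite expnS; lia.
Qed.

Lemma tau_uniform k j x : (k0 <= k)%N ->
  (forall i, (k <= i < k + j)%N -> forall y, riesz_factor R pi i y = 0) ->
  tau (k + j) x = tau k (fun l => x l %/ 2 ^ j)%N / 2 ^+ (d * j).
Proof.
move=> k0k; elim: j x => [|j IHj] x H.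
  rewrite addn0 muln0 expr0 divr1; congr tau.
  by apply/funext => l; rewrite expn0 divn1.
rewrite addnS tau_step; last by lia.
rewrite H ?mul0r ?addr0 ?mulr1; last by lia.
rewrite IHj => [|i hi]; last by apply: H; lia.
have -> : (fun l => x l %/ 2 %/ 2 ^ j)%N = (fun l => x l %/ 2 ^ j.+1)%N.
  by apply/funext => l; rewrite -divnMA expnS.
by rewrite mulnSr exprD invfM mulrA.
Qed.

Lemma tau_block s (x y : 'I_d -> 'I_(2 ^ mseq s)) : (k0 <= mseq s)%N ->
  tau (2 * mseq s) (fun j => 2 ^ mseq s * x j + y j)%N =
  tau (mseq s) (fun j => val (x j)) / 2 ^+ (d * mseq s).
Proof.
move=> k0s; rewrite mul2n -addnn tau_uniform //.
  congr (tau _ _ / _); apply/funext => j.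
  by rewrite mulnC divnMDl ?expn_gt0 // divn_small // addn0.
move=> i hi z; apply: riesz_factor_eq0 => r ir.
(* No rank [2 * mseq r] lies in [[mseq s, 2 * mseq s)]: it is below [mseq s] for [r < s] and at
   least [2 * mseq s] otherwise. *)
case: (ltngtP r s) => [/mseq_ltn|/mseq_ltn|E]; try lia.
by move: ir; rewrite E; lia.
Qed.

Lemma riesz_factor_block s (x y : 'I_d -> 'I_(2 ^ mseq s)) :
  riesz_factor R pi (2 * mseq s) (fun j => 2 ^ mseq s * x j + y j)%N =
  \prod_(l < d) W1 R (pi s l (x l)) (digits (mseq s) (y l)).
Proof. by rewrite riesz_factor_mseq -(@Psi_cube R d pi s x y) //; apply: cube_pt_in. Qed.

(** * Partial sums at a point near which the quasimeasure vanishes *)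

Section AtPoint.
Variables (g : pt d) (k1 : nat).
Hypothesis k0k1 : (k0 <= k1)%N.
Hypothesis tau_eq0 : forall k x, (k1 <= k)%N ->
  (forall l t, (t < k1)%N -> digits k (x l) t = g l t) -> tau k x = 0.

Lemma psum_block s N : (k1 <= mseq s)%N ->
  (forall j, (2 ^ (2 * mseq s) <= N j <= 2 ^ (2 * mseq s).+1)%N) ->
  `|psum a N g| <=
  \sum_(x : {ffun 'I_d -> 'I_(2 ^ mseq s)}) `|tau (mseq s) (fun j => val (x j))| *
    \prod_(l < d) `|dirichlet R
       (minn (2 ^ mseq s) (N l - 2 ^ (2 * mseq s) - 2 ^ mseq s * pi s l (x l)))
       (xor (g l) (digits (mseq s) (x l)))|.
Proof.
move=> k1s hN; set m := mseq s in k1s hN *; set k := (2 * m)%N in hN *.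
have k0k : (k0 <= k)%N by rewrite /k; lia.
have k1k : (k1 <= k)%N by rewrite /k; lia.
rewrite (psum_qint (tau := tau) (k := k.+1)) //; first last.
- by move=> n hn; apply: aE.
- by move=> j; case/andP: (hN j) => h ->; rewrite andbT (leq_trans _ h) ?expn_gt0.
rewrite (qintS _ (tau_step k0k)).
(* [D1] is the mean of the kernel over the new digit and [D2] its half difference; they carry the
   complete part and the incomplete block. *)
pose D1 l x := dirichlet R (2 ^ k) (xor (g l) (digits k x)).
pose D2 l x := (-1) ^+ g l k * dirichlet R (N l - 2 ^ k) (xor (g l) (digits k x)).
have dE l x : dirichlet R (N l) (xor (g l) (digits k.+1 x)) =
    D1 l (x %/ 2)%N + (-1) ^+ x * D2 l (x %/ 2)%N.
  exact: dirichlet_digitsS.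
have h2 (x : nat) : (2 * x %/ 2 = x)%N by lia.
have h21 (x : nat) : ((2 * x + 1) %/ 2 = x)%N by lia.
have sg (x : nat) : (-1) ^+ (2 * x) = 1 :> R by rewrite exprM sqrrN !expr1n.
rewrite (@eq_qint R d tau k _ D1) => [|l x _]; last first.
  by rewrite !dE h2 h21 exprD sg expr1; field.
rewrite [X in _ + X](@eq_qint R d _ k _ D2) => [|l x _]; last first.
  by rewrite !dE h2 h21 exprD sg expr1; field.
(* The kernel of order [2 ^ k] vanishes off the cube of rank [k] around [g], and on that cube [tau]
   vanishes. *)
rewrite [X in X + _](_ : _ = 0) ?add0r; last first.
  apply: big1 => x _.
  have [near|] := boolP [forall l, forall t : 'I_k, digits k (x l) t == g l t].
    rewrite tau_eq0 ?mul0r // => l t tk1; apply/eqP.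
    by have /forallP/(_ l)/forallP/(_ (Ordinal (leq_trans tk1 k1k))) := near.
  rewrite negb_forall => /existsP[l]; rewrite negb_forall => /existsP[t ne].
  rewrite (bigD1 l) //= {1}/D1 (dirichlet_exp2_eq0 _ (ltn_ord t)) ?mul0r ?mulr0 //.
  by rewrite /xor addbC -negb_eqb.
rewrite /qint.
pose F (z : 'I_d -> nat) := tau k z * riesz_factor R pi k z * \prod_(l < d) D2 l (z l).
have Ek : (2 ^ k = 2 ^ m * 2 ^ m)%N by rewrite /k mul2n -addnn expnD.
rewrite (sum_ffun_mul_add F (expn_gt0 2 m) Ek).
apply: le_trans (ler_norm_sum _ _ _) _; apply: ler_sum => x _.
rewrite /F.
have lN l : (N l - 2 ^ k <= 2 ^ (m + m))%N.
  by have := hN l; rewrite expnS addnn -mul2n -/k; lia.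
have -> : \sum_(y : {ffun 'I_d -> 'I_(2 ^ m)})
    tau k (fun j => 2 ^ m * x j + y j)%N *
    riesz_factor R pi k (fun j => 2 ^ m * x j + y j)%N *
    \prod_(l < d) D2 l (2 ^ m * x l + y l)%N =
  tau m (fun j => val (x j)) * \prod_(l < d) ((-1) ^+ g l k *
    (W1 R (pi s l (x l)) (shift m (g l)) *
     dirichlet R (minn (2 ^ m) (N l - 2 ^ k - 2 ^ m * pi s l (x l)))
       (xor (g l) (digits m (x l))))).
  (* [tau] does not depend on the second half [y] of the digits; its factor [2 ^- (d * m)] is shared
     out over the coordinates, so the sum over [y] becomes a product. *)
  transitivity (\sum_(y : {ffun 'I_d -> 'I_(2 ^ m)})
     tau m (fun j => val (x j)) * \prod_(l < d) ((2 ^ m)%:R^-1 * (-1) ^+ g l k *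
      (W1 R (pi s l (x l)) (digits m (y l)) *
       dirichlet R (N l - 2 ^ k) (xor (g l) (digits (m + m) (2 ^ m * x l + y l)))))).
    apply: eq_bigr => y _; rewrite tau_block ?(leq_trans k0k1) // riesz_factor_block.
    rewrite -mulrA -mulrA; congr (_ * _).
    rewrite !big_split /= prodr_const card_ord -/m natrX exprVn -exprM [(m * d)%N]mulnC.
    rewrite addnn -mul2n -/k; ring.
  rewrite -mulr_sumr; congr (_ * _).
  rewrite -(bigA_distr_bigA (fun l (y : 'I_(2 ^ m)) => (2 ^ m)%:R^-1 * (-1) ^+ g l k *
      (W1 R (pi s l (x l)) (digits m y) *
       dirichlet R (N l - 2 ^ k) (xor (g l) (digits (m + m) (2 ^ m * x l + y)))))) /=.
  apply: eq_bigr => l _; rewrite -mulr_sumr sum_W1_dirichlet //.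
  have n0 : (2 ^ m)%:R != 0 :> R by rewrite pnatr_eq0 expn_eq0.
  by field.
rewrite normrM normr_prod ler_wpM2l //; apply: ler_prod => l _.
by rewrite normr_ge0 !normrM normr_sign normr_W1 !mul1r lexx.
Qed.

Lemma psum_block_le s N : (k1 <= mseq s)%N ->
  (forall j, (2 ^ (2 * mseq s) <= N j <= 2 ^ (2 * mseq s).+1)%N) ->
  `|psum a N g| <= d%:R * 2 ^+ (k1 + d) / 2 ^+ s.
Proof.
move=> k1s hN; apply: le_trans (psum_block k1s hN) _.
set m := mseq s in k1s hN *; set k := (2 * m)%N in hN *.
pose K l (x : 'I_(2 ^ m)) : R := `|dirichlet R
       (minn (2 ^ m) (N l - 2 ^ k - 2 ^ m * pi s l x)) (xor (g l) (digits m x))|.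
pose far l (x : 'I_(2 ^ m)) := [exists t : 'I_k1, g l t != digits m x t].
have K0 l x : 0 <= K l x by apply: normr_ge0.
pose c : R := 2 ^+ uphalf m / 2 ^+ (d * m).
have c0 : 0 <= c by rewrite divr_ge0 ?exprn_ge0.
(* A cube that is far in no coordinate has [tau = 0]; any other one is charged to a coordinate [l0]
   in which it is far from [g]. *)
apply: le_trans (_ : \sum_(x : {ffun 'I_d -> 'I_(2 ^ m)}) \sum_(l0 < d)
    c * \prod_(l < d) (((l == l0) ==> far l (x l))%:R * K l (x l)) <= _).
  apply: ler_sum => x _; rewrite -/(\prod_(l < d) K l (x l)).
  have [nf|] := boolP [forall l, ~~ far l (x l)].
    rewrite tau_eq0 // ?normr0 ?mul0r => [|l t tk1].
      apply: sumr_ge0 => l0 _; rewrite mulr_ge0 // prodr_ge0 // => l _.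
      by rewrite mulr_ge0.
    have := forallP nf l; rewrite negb_exists => /forallP /(_ (Ordinal tk1)).
    by rewrite negbK eq_sym => /eqP.
  rewrite negb_forall => /existsP[l0]; rewrite negbK => fl0.
  apply: le_trans (_ : c * \prod_(l < d) K l (x l) <= _).
    by rewrite ler_wpM2r ?prodr_ge0 // tau_le // (leq_trans k0k1).
  rewrite [leRHS](bigD1 l0) //= [X in c * X](_ : _ =
      \prod_(l < d) (((l == l0) ==> far l (x l))%:R * K l (x l))); last first.
    apply: eq_bigr => l _; case: eqP => [->|_] /=; rewrite ?fl0 mul1r //.
  rewrite lerDl sumr_ge0 // => l1 _; rewrite mulr_ge0 // prodr_ge0 // => l _.
  by rewrite mulr_ge0.
rewrite exchange_big /=.
(* Each coordinate sum is at most [2 * 2 ^ m]; the far coordinate has the bound [2 ^ k1] instead,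
   which the last quotient accounts for. *)
pose B : R := c * ((2 * (2 ^ m)%:R) ^+ d * ((2 ^ k1)%:R / (2 ^ m)%:R)).
have m0 : 0 < (2 ^ m)%:R :> R by rewrite ltr0n expn_gt0.
apply: le_trans (_ : \sum_(l0 < d) B <= _).
  apply: ler_sum => l0 _; rewrite -mulr_sumr ler_wpM2l //.
  rewrite -(bigA_distr_bigA (fun l (x : 'I_(2 ^ m)) =>
     ((l == l0) ==> far l x)%:R * K l x)) /=.
  apply: le_trans (_ : \prod_(l < d) (2 * (2 ^ m)%:R *
     (if l == l0 then (2 ^ k1)%:R / (2 ^ m)%:R else 1)) <= _).
    apply: ler_prod => l _; rewrite sumr_ge0 /= => [|x _]; last by rewrite mulr_ge0.
    case: eqP => _ /=.
      rewrite (_ : \sum_x _ = \sum_(x | far l x) K l x); last first.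
        by rewrite [RHS]big_mkcond; apply: eq_bigr => x _; case: far; rewrite ?mul1r ?mul0r.
      apply: le_trans (sum_kernel_far_le _ _ _ _ k1s) _.
      rewrite (_ : _ * _ = 2 * (2 ^ k1)%:R); last by field; apply/lt0r_neq0.
      have : 0 <= (2 ^ k1)%:R :> R by [].
      lra.
    rewrite mulr1; under eq_bigr => x _ do rewrite mul1r.
    exact: sum_kernel_le.
  rewrite big_split /= prodr_const card_ord ler_wpM2l ?exprn_ge0 ?mulr_ge0 //.
  by rewrite (bigD1 l0) //= eqxx big1 ?mulr1 // => l /negbTE ->.
rewrite sumr_const card_ord -[leLHS]mulr_natl -[leRHS]mulrA ler_wpM2l //.
have -> : B = 2 ^+ (k1 + d) / 2 ^+ (m./2).
  have Em : 2 ^+ m = 2 ^+ uphalf m * 2 ^+ m./2 :> R.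
    by rewrite -exprD; congr (_ ^+ _); rewrite uphalf_half; lia.
  have n0 j : 2 ^+ j != 0 :> R by rewrite expf_neq0 ?pnatr_eq0.
  rewrite /B /c !natrX exprMn -exprM [(m * d)%N]mulnC exprD.
  have : 2 ^+ m != 0 :> R by [].
  rewrite Em; have := n0 (d * m)%N; move: (2 ^+ (d * m)) => z z0 h.
  by field; rewrite z0 !n0.
rewrite ler_wpM2l ?exprn_ge0 // lef_pV2 ?posrE ?exprn_gt0 //.
(* The decay [2 ^- (m./2)] is weakened to [2 ^- s] by [2 * s <= mseq s]. *)
rewrite ler_weXn2l //; last by have := mseq_ge s; lia.
lra.
Qed.

(** One coordinate below [2 ^ (2 * mseq s.+1)] excludes all diagonal blocks after block [s], since
    they need every coordinate large; block [s] itself ends at [2 ^ (2 * mseq s).+1]. *)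
Lemma psum_clip s N : (k0 <= 2 * mseq s)%N ->
  (forall j, 0 < N j)%N -> (exists j, N j < 2 ^ (2 * mseq s.+1))%N ->
  psum a N g = psum a (fun j => minn (N j) (2 ^ (2 * mseq s).+1)) g.
Proof.
move=> k0s N0 [j0 hj0]; set M := fun j => minn _ _.
pose B := (\max_(j < d) N j)%N.
have NB j : (N j <= B)%N by apply: (leq_bigmax j).
rewrite (@psum_widen R d B a N) //; last first.
  by apply: leq_trans (leq_bigmax (Ordinal d_gt0)).
rewrite (@psum_widen R d B a M); first last.
- by move=> j; rewrite geq_min NB.
- apply: leq_trans (leq_bigmax (Ordinal d_gt0)).
  by rewrite /M leq_min N0 expn_gt0.
rewrite big_mkcond [RHS]big_mkcond /=; apply: eq_bigr => n _.
have [->|an0] := eqVneq (a (fun j => val (n j))) 0; first by rewrite mul0r !if_same.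
suff -> : [forall j, (n j < M j)%N] = [forall j, (n j < N j)%N] by [].
apply/forallP/forallP => H j; first by have := H j; rewrite leq_min => /andP[].
rewrite leq_min H /=; case: (spectrum an0) => [/(_ j) /= h|[i [_ /= hi]]].
  by apply: leq_trans h _; rewrite leq_exp2l //; lia.
have /andP[_ h] := hi j; apply: leq_trans h _; rewrite leq_exp2l // ltnS.
case: (leqP i s) => [|si].
  by rewrite leq_eqVlt => /orP[/eqP -> //|/mseq_ltn]; lia.
have /andP[h _] := hi j0.
have : (2 ^ (2 * mseq i) < 2 ^ (2 * mseq s.+1))%N.
  by apply: leq_ltn_trans h (ltn_trans (H j0) hj0).
rewrite ltn_exp2l //; move: si; rewrite leq_eqVlt => /orP[/eqP -> |/mseq_ltn]; lia.
Qed.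

Lemma cvg_rect0 : cvg_rect a g 0.
Proof.
move=> e e0; pose C : R := d%:R * 2 ^+ (k1 + d).
have C0 : 0 <= C by rewrite mulr_ge0 ?exprn_ge0.
(* [r] makes [C / 2 ^+ s < e] and the summand [k1] gives [k1 <= mseq s], both from [s1] on. *)
pose r := Num.bound (C / e); pose s1 := (r + k1)%N.
have small s : (s1 <= s)%N -> C / 2 ^+ s < e.
  move=> hs; rewrite ltr_pdivrMr ?exprn_gt0 // mulrC -ltr_pdivrMr //.
  apply: lt_le_trans (archi_boundP _) _; first by rewrite divr_ge0 // ltW.
  rewrite -natrX ler_nat; apply: leq_trans (ltnW (ltn_expl _ (ltnSn 1))) _.
  by rewrite leq_exp2l //; apply: leq_trans hs; rewrite leq_addr.
exists (2 ^ (2 * mseq s1))%N => N hN.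
(* The last block whose starting corner lies below [N] is the only one that can be incomplete. *)
pose P s := [forall j, (2 ^ (2 * mseq (s1 + s)) <= N j)%N].
have exP : exists s, P s by exists 0%N; apply/forallP => j; rewrite addn0.
have bP s : P s -> (s <= N (Ordinal d_gt0))%N.
  move=> /forallP /(_ (Ordinal d_gt0)); apply: leq_trans.
  apply: leq_trans (ltnW (ltn_expl _ (ltnSn 1))) _; rewrite leq_exp2l //.
  by have := mseq_ge (s1 + s); lia.
have [s /forallP Ps maxs] := ex_maxnP exP bP.
have [j0 hj0] : exists j, (N j < 2 ^ (2 * mseq (s1 + s).+1))%N.
  have : ~~ P s.+1 by apply/negP => /maxs; rewrite ltnn.
  by rewrite negb_forall => /existsP[j]; rewrite -ltnNge addnS => h; exists j.
have k1s : (k1 <= mseq (s1 + s))%N by have := mseq_ge (s1 + s); rewrite /s1; lia.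
rewrite subr0 (@psum_clip (s1 + s)); first last.
- by exists j0.
- by move=> j; apply: leq_trans (Ps j); rewrite expn_gt0.
- by lia.
apply: le_lt_trans (psum_block_le k1s _) _.
  by move=> j; rewrite leq_min Ps geq_minr leq_exp2l ?leqnSn.
by apply: small; rewrite leq_addr.
Qed.

End AtPoint.
End RieszProduct.

(** * Restriction to a dyadic cube *)

Section Restriction.
Variables (R : realType) (d : nat) (pi : forall i : nat, 'I_d -> {perm 'I_(2 ^ mseq i)}).
Variables (k0 : nat) (m0 : 'I_d -> nat).
Hypothesis d_gt0 : (0 < d)%N.
Hypothesis m0_lt : forall j, (m0 j < 2 ^ k0)%N.

Local Notation tauF := (tauE R (Fpi R pi)).
Local Notation tau := (restr tauF k0 m0).

Lemma sub_cube k k' (x x' : 'I_d -> nat) : (k' <= k)%N ->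
  (forall g, cube k x g -> cube k' x' g) <-> cube k' x' (cube_pt k x).
Proof.
move=> kk'; split=> [H|/cubeE H g /cubeE C]; first exact/H/cube_pt_in.
by apply/cubeE => l t tk; rewrite C ?H // (leq_trans tk).
Qed.

Lemma restr_large k x : (k0 <= k)%N ->
  tau k x = if `[< cube k0 m0 (cube_pt k x) >] then tauF k x else 0.
Proof. by move=> h; rewrite /restr h (asbool_equiv_eq (sub_cube _ _ h)). Qed.

Lemma restr_small k x : (k <= k0)%N -> (forall j, (x j < 2 ^ k)%N) ->
  tau k x = if `[< cube k x (cube_pt k0 m0) >] then tauF k0 m0 else 0.
Proof.
rewrite leq_eqVlt => /orP[/eqP kk0|kk0] xk; last first.
  by rewrite /restr leqNgt kk0 /= (asbool_equiv_eq (sub_cube _ _ (ltnW kk0))).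
(* At [k = k0] the definition of [restr] takes its first branch; both branches agree because nested
   cubes of equal rank coincide. *)
rewrite kk0 in xk *; rewrite restr_large //.
have [->|ne] := pselect (x = m0); first by [].
have nE (u v : 'I_d -> nat) : (forall j, (u j < 2 ^ k0)%N) -> (forall j, (v j < 2 ^ k0)%N) ->
    cube k0 u (cube_pt k0 v) -> v = u.
  move=> hu hv /cubeE H; apply/funext => j; apply: (@digits_inj k0) => // t tk.
  exact: (H j t tk).
rewrite !asboolF // => /nE E; apply: ne; [exact/esym/E|exact/E].
Qed.

Lemma restr_riesz_step k : (k0 <= k)%N -> riesz_step tau (riesz_factor R pi) k.
Proof.
move=> h x; rewrite !restr_large ?(leqW h) // tauE_riesz_step //.
set y := fun j => _.
have E : cube k0 m0 (cube_pt k.+1 x) <-> cube k0 m0 (cube_pt k y).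
  by split=> /cubeE H; apply/cubeE => l t tk;
    rewrite -H // cube_ptS_low // (leq_trans tk).
by rewrite (asbool_equiv_eq E); case: asboolP => _ //; rewrite !mul0r.
Qed.

Lemma restr_le k x : (k0 <= k)%N -> `|tau k x| <= 2 ^+ uphalf k / 2 ^+ (d * k).
Proof.
move=> h; rewrite restr_large //; case: asboolP => _; first exact: normr_tauE.
by rewrite normr0 divr_ge0 ?exprn_ge0.
Qed.

(** Up to rank [k0] a single cube carries the whole mass, the one containing the cube [m0]. *)
Lemma coef_restr_small k n : (k <= k0)%N -> (forall j, (n j < 2 ^ k)%N) ->
  coef tau k n = tauF k0 m0 * Wv R n (cube_pt k0 m0).
Proof.
move=> kk0 hn.
pose z : {ffun 'I_d -> 'I_(2 ^ k)} := [ffun j => prefix_ord k (cube_pt k0 m0 j)].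
have zE l t : (t < k)%N -> digits k (z l) t = cube_pt k0 m0 l t.
  by move=> tk; rewrite ffunE digits_prefix_val.
rewrite /coef /qint (bigD1 z) //= [X in _ + X]big1 ?addr0 => [|y yz].
  rewrite restr_small // asboolT; last by apply/cubeE => l t tk; rewrite -zE.
  by congr (_ * _); apply: eq_bigr => l _; apply: (W1_eq_prefix _ (hn l)) => t /zE.
rewrite restr_small //; case: asboolP => [/cubeE H|_]; last by rewrite mul0r.
case/eqP: yz; apply/ffunP => l; apply: val_inj.
apply: (digits_inj (ltn_ord _) (ltn_ord _)) => t tk.
by rewrite zE // (H l t tk).
Qed.

Lemma coef_restrS k n : (forall j, (n j < 2 ^ k)%N) -> coef tau k.+1 n = coef tau k n.
Proof.
move=> hn; case: (leqP k0 k) => h; first by rewrite (coefS_low (restr_riesz_step h)).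
rewrite !coef_restr_small //; first exact: ltnW.
by move=> j; apply: leq_trans (hn j) _; rewrite leq_exp2l.
Qed.

Lemma coef_restrD k j n : (forall j, (n j < 2 ^ k)%N) -> coef tau (k + j) n = coef tau k n.
Proof.
move=> hn; elim: j => [|j IHj]; first by rewrite addn0.
rewrite addnS coef_restrS // => i; apply: leq_trans (hn i) _.
by rewrite leq_exp2l // leq_addr.
Qed.

(** [gen] computes at rank [M], the largest coordinate; both ranks are compared with [M + k]. *)
Lemma gen_restr k n : (forall j, (n j < 2 ^ k)%N) -> gen tau n = coef tau k n.
Proof.
move=> hn; rewrite genE; set M := \max_(j < d) n j.
rewrite -(@coef_restrD M k) => [|j]; last first.
  exact: leq_ltn_trans (leq_bigmax j) (ltn_expl _ _).
by rewrite addnC coef_restrD.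
Qed.

(** The complement of the support is open: leaving the cube shows in the first [k0] digits, and a
    failing [Fs] in the first [2 * mseq i + 1]. *)
Lemma restr_vanish g : ~ (cube k0 m0 g /\ Fpi R pi g) ->
  exists2 k1, (k0 <= k1)%N & forall k x, (k1 <= k)%N ->
    (forall l t, (t < k1)%N -> digits k (x l) t = g l t) -> tau k x = 0.
Proof.
move=> nA; have [Cg|nCg] := pselect (cube k0 m0 g); last first.
  exists k0 => // k x kk H; rewrite restr_large // asboolF // => /cubeE C.
  by apply: nCg; apply/cubeE => l t tk; rewrite -C // -H.
have [i nF] : exists i, ~ Fs R pi i g by apply/existsNP => F; apply: nA.
exists (k0 + (2 * mseq i).+1)%N => [|k x kk H]; first exact: leq_addr.
rewrite restr_large; last by lia.
case: asboolP => // _; apply: tauE_eq0 => // /(meets_FpiE _ _ d_gt0) /(_ i) F.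
apply: nF; apply: Fs_eq (F _) => [l t tk|]; last by lia.
by apply: H; lia.
Qed.

Lemma gen_restr_realizes (A : pt d -> Prop) :
  meets (cube k0 m0) (Fpi R pi) ->
  (forall g, cube k0 m0 g -> Fpi R pi g -> A g) ->
  [/\ realizes (@cvg_rect R d) A (gen tau),
      realizes (@cvg_cube R d) A (gen tau) &
      forall l : seq 'I_d, perm_eq l (enum 'I_d) ->
        realizes (@cvg_rep R d l) A (gen tau)].
Proof.
move=> M sA.
have nz : exists n, gen tau n != 0.
  (* The coefficient of index 0 is the total mass, which is positive because the cube meets F. *)
  exists (fun=> 0%N); rewrite (@gen_restr 0%N) // coef_restr_small //.
  rewrite /Wv big1 ?mulr1 => [|l _]; last exact: W1_0.
  exact/lt0r_neq0/tauE_gt0.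
have cv g : ~ A g -> cvg_rect (gen tau) g 0.
  move=> nA; have [|k1 k01 H] := @restr_vanish g.
    by case=> Cg Fg; apply/nA/sA.
  exact: (cvg_rect0 d_gt0 restr_riesz_step restr_le gen_restr k01 H).
split=> [||l pl]; split=> // g /cv //; first exact: cvg_cube_of_rect.
apply: cvg_rep_of_rect (pl) => // n i j.
exact: (spectrum_diag d_gt0 restr_riesz_step gen_restr).
Qed.

End Restriction.

(** * Choice of the dyadic cube inside the open set *)

Theorem theorem6 (R : realType) (d : nat) (hd : (2 <= d)%N)
    (pi : forall i : nat, 'I_d -> {perm 'I_(2 ^ mseq i)})
    (G : pt d -> Prop) (hG : is_open G)
    (hGF : exists g, G g /\ Fpi R pi g) :
  let A := fun g => G g /\ Fpi R pi g in
  [/\ Mset (@cvg_rect R d) A,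
      Mset (@cvg_cube R d) A,
      (forall l : seq 'I_d, perm_eq l (enum 'I_d) -> Mset (@cvg_rep R d l) A) &
      exists (s0 : nat) (m0 : 'I_d -> nat),
        [/\ (forall j, (m0 j < 2 ^ mseq s0)%N),
            (forall g, cube (mseq s0) m0 g -> G g) &
            let a := gen (restr (tauE R (Fpi R pi)) (mseq s0) m0) in
            [/\ realizes (@cvg_rect R d) A a,
                realizes (@cvg_cube R d) A a &
                forall l : seq 'I_d, perm_eq l (enum 'I_d) ->
                  realizes (@cvg_rep R d l) A a]]].
Proof.
move=> A; have d_gt0 : (0 < d)%N by apply: ltnW.
have [g [Gg Fg]] := hGF; have [k [m [_ [Cg sG]]]] := hG g Gg.
(* Since [k <= mseq k], the cube of rank [mseq k] around [g] lies in the given cube of rank [k],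
   hence in [G]. *)
pose k0 := mseq k; pose m0 (j : 'I_d) := prefix_val k0 (g j).
have kk0 : (k <= k0)%N by have := mseq_ge k; rewrite /k0; lia.
have m0_lt j : (m0 j < 2 ^ k0)%N by apply: prefix_val_lt.
have C0g : cube k0 m0 g.
  by apply/cubeE => l t tk; apply/esym/(digits_prefix_val _ tk).
have sG0 h : cube k0 m0 h -> G h.
  move=> /cubeE H; apply: sG => l t tk.
  rewrite (H l t (leq_trans tk kk0)) -(Cg l t tk).
  exact/digits_prefix_val/(leq_trans tk).
have M : meets (cube k0 m0) (Fpi R pi) by exists g.
have [rr rc rp] := gen_restr_realizes d_gt0 m0_lt M (fun h C F => conj (sG0 h C) F).
split; [by eexists; exact: rr|by eexists; exact: rc| |by exists k, m0].
by move=> l pl; eexists; apply: rp pl.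
Qed.
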